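(* Let $E,F\subset\mathbb{C}$ be the unique nonempty compact sets satisfying $E=\frac13(E+\mathcal{D}_E)$ and $F=\frac13(F+\mathcal{D}_F)$, where $\mathcal{D}_E=\{0,\,1,\,2,\,2+i,\,1+2i\}$ and $\mathcal{D}_F=\{1+2i,\,1+i,\,1,\,0,\,2+i\}$. Let $s=\dim_H E=\log 5/\log 3$ and $c=\mathcal{H}^s(E)/\mathcal{H}^s(F)$. Then there exists a bi-Lipschitz map $f:E\to F$ which is measure-preserving in the sense that for every Borel set $B\subset E$, $$\mathcal{H}^s(B)=c\,\mathcal{H}^s(f(B)).$$
   Context: $\mathbb{C}$ is identified with $\mathbb{R}^2$, with the Euclidean distance. $\mathcal{H}^s$ is $s$-dimensional Hausdorff measure and $\dim_H$ is Hausdorff dimension. For a set $A$ and a finite set $\mathcal{D}$, $\frac13(A+\mathcal{D})=\{\frac13(a+d): a\in A, d\in\mathcal{D}\}$. A bi-Lipschitz map $f:X\to Y$ between metric spaces $(X,d_X)$, $(Y,d_Y)$ is a bijection for which there is a constant $C>0$ with $C^{-1}d_X(x_1,x_2)\le d_Y(f(x_1),f(x_2))\le C\,d_X(x_1,x_2)$ for all $x_1,x_2\in X$. *)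

(* Defs.v *)
From HB Require Import structures.
From mathcomp Require Import all_boot all_order all_algebra.
From mathcomp Require Import all_classical all_reals all_analysis.
From mathcomp Require Import complex.

Set Implicit Arguments.
Unset Strict Implicit.
Unset Printing Implicit Defensive.

Import Order.TTheory GRing.Theory Num.Theory.
Import numFieldNormedType.Exports.

Local Open Scope classical_set_scope.
Local Open Scope ring_scope.
Local Open Scope complex_scope.

(* MathComp-Analysis puts the topology of the modulus on the regular module
   [K^o] of any [K : numFieldType]; transport it to [R[i]] itself. *)
HB.instance Definition _ (R : realType) := NormedModule.copy R[i] R[i]^o.

(* The norm [`|_|] of [R[i]] is valued in [R[i]]; [Normc.normc], which sends
   [a +i* b] to [Num.sqrt (a ^+ 2 + b ^+ 2)], is its version valued in [R]. *)
Definition cdist (R : realType) (x y : R[i]) : R := Normc.normc (x - y).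

(* Adding [0] to the set of distances only serves to give [diam set0 = 0]
   instead of [-oo]. *)
Definition diam (R : realType) (A : set R[i]) : \bar R :=
  ereal_sup (0%E |` [set (cdist x y)%:E | x in A & y in A]).

(* [diam U ^ s], with the convention that the empty set contributes [0] also
   when [s = 0]; nonempty sets contribute [0 ^ 0 = 1] when they have diameter
   [0] and [s = 0]. *)
Definition diam_pow (R : realType) (s : R) (U : set R[i]) : \bar R :=
  if U == set0 then 0%E else (diam U `^ s)%E.

Definition hausdorff_content (R : realType) (s delta : R) (A : set R[i]) :
    \bar R :=
  ereal_inf [set (\sum_(0 <= n <oo) diam_pow s (U n))%E | U in
    [set U : nat -> set R[i] |
      A `<=` \bigcup_n U n /\ forall n, (diam (U n) <= delta%:E)%E]].

(* Hausdorff measure, as an outer measure defined on all subsets of the plane,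
   without normalizing constant. *)
Definition hausdorff_measure (R : realType) (s : R) (A : set R[i]) : \bar R :=
  ereal_sup [set hausdorff_content s delta A | delta in [set d : R | 0 < d]].

Definition hausdorff_dim (R : realType) (A : set R[i]) : \bar R :=
  ereal_inf [set s%:E | s in
    [set s : R | 0 <= s /\ hausdorff_measure s A = 0%E]].

Definition borel (R : realType) : set (set R[i]) :=
  <<s [set U : set R[i] | open U] >>.

Definition third_sum (R : realType) (A : set R[i]) (D : seq R[i]) : set R[i] :=
  [set 3^-1 * (a + d) | a in A & d in [set` D]].

Definition is_attractor (R : realType) (D : seq R[i]) (A : set R[i]) : Prop :=
  [/\ A !=set0, compact A & A = third_sum A D].

Definition digitsE (R : realType) : seq R[i] :=
  [:: 0; 1; 2; 2 +i* 1; 1 +i* 2].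

Definition digitsF (R : realType) : seq R[i] :=
  [:: 1 +i* 2; 1 +i* 1; 1; 0; 2 +i* 1].

(* Only the restriction of [f] to [X] matters. *)
Definition bilipschitz (R : realType) (X Y : set R[i]) (f : R[i] -> R[i]) :
    Prop :=
  set_bij X Y f /\
  exists2 C : R, 0 < C & forall x1 x2, X x1 -> X x2 ->
    C^-1 * cdist x1 x2 <= cdist (f x1) (f x2) <= C * cdist x1 x2.

(* Main.v *)
(* Code both sets by the sequences of digits of [F].  A finite automaton maps the
   level-n cells of [F] bijectively onto those of [E], keeping track of the pairs
   of cells of [E] that touch vertically.  Two cells that are close on one side
   are close on the other side, so the point map [Fpoint a |-> Epoint Single a]
   is bi-Lipschitz; its inverse is [f].

   Each cylinder of level [n] has an image of measure at most [5 ^- n] times the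
   whole, in [F] and in [E].  Transporting the Lebesgue measure of [0, 1[ by
   base 5 digits, one gets [H^s (h S) <= H^s (range h) * lambda S] for both codings
   [h]; this applied to [S] and to its complement forces equality when [S] is
   measurable, so the Hausdorff measures of [B] and of [f @` B] are both
   proportional to the Lebesgue measure of the same set of codes.  The mass
   distribution principle for [lambda] shows that [H^s F] is positive. *)
Require Import Defs.
From HB Require Import structures.
From mathcomp Require Import all_boot all_order all_algebra.
From mathcomp Require Import all_classical all_reals all_analysis.
From mathcomp Require Import complex ring lra zify.

Set Implicit Arguments.
Unset Strict Implicit.
Unset Printing Implicit Defensive.

Import Order.TTheory GRing.Theory Num.Theory.
Import numFieldNormedType.Exports.

Local Open Scope classical_set_scope.
Local Open Scope ring_scope.

(** * The automaton on cells *)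

(** Neighbouring cells of [F] meet only when one is above the other; neighbouring cells of [E] also
    meet when they are side by side. Matching digit with digit turns the vertical contacts of [F]
    into the horizontal contacts of [E]. The vertical contacts of [E] are left over, and they bring
    arbitrarily close points that [F] would keep apart. Such a contact is a single point: the top
    subcell (digit 4) of the lower cell touches subcell 1 of the upper cell. Exchanging the top
    subcells assigns both of these to the upper cell's code, so the contact is now between digits 1
    and 4 of one cell, again horizontal neighbours in [F]: the same situation one level deeper. Two
    stacked cells thus split into four single cells and three stacked pairs, which is why three
    states suffice. The price is that the part of [E] coded by a member of a pair need not be a
    similar copy of [E], so its measure has to be compared with that of [E] separately. *)

(* Digit number [d] of [F] is matched with digit number [d] of [E], except that
   vertically adjacent cells of [E] come in pairs, which are matched with two
   horizontally neighbouring (but disjoint) cells of [F].  [Lower] and [Upper]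
   are the members of such a pair, [Single] is any other cell.  Inside a pair
   the top subcells (digit 4) are exchanged: [swap] is the height difference,
   in cells, and [next] is the resulting state of the subcell. *)
Inductive state := Single | Lower | Upper.

Definition Fx (d : 'I_5) : int := nth 0 [:: 1; 1; 1; 0; 2] d.
Definition Fy (d : 'I_5) : int := nth 0 [:: 2; 1; 0; 0; 1] d.
Definition Ex (d : 'I_5) : int := nth 0 [:: 0; 1; 2; 2; 1] d.
Definition Ey (d : 'I_5) : int := nth 0 [:: 0; 0; 0; 1; 2] d.

Definition next (s : state) (d : 'I_5) : state :=
  nth Single (if s is Upper then [:: Single; Upper; Lower; Upper; Lower]
              else [:: Single; Single; Lower; Upper; Single]) d.

Definition swap (s : state) (d : 'I_5) : int :=
  nth 0 [:: 0; 0; 0; 0; match s with Single => 0 | Lower => 1 | Upper => -1 end] d.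

Section DigitGeometry.
Implicit Types (x y : int) (d e : 'I_5).

Let dcase (P : 'I_5 -> Prop) :
  P (@Ordinal 5 0 isT) -> P (@Ordinal 5 1 isT) -> P (@Ordinal 5 2 isT) ->
  P (@Ordinal 5 3 isT) -> P (@Ordinal 5 4 isT) -> forall d, P d.
Proof.
move=> h0 h1 h2 h3 h4 [[|[|[|[|[|//]]]]] h];
by rewrite (bool_irrelevance h isT).
Qed.

(** Throughout the section [x] and [y] stand for the differences of the positions of two parent
    cells and [d], [e] for the digits of two children; the left-hand sides are the differences for
    the children. Every statement is a check of the 25 pairs of digits. *)
Lemma Fdig_eq x y d e : 3 * x + (Fx d - Fx e) = 0 -> 3 * y + (Fy d - Fy e) = 0 ->
  [/\ x = 0, y = 0 & d = e].
Proof.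
by move: d e; do 2![apply: dcase]; rewrite /Fx /Fy /= => hx hy; try lia; split => //; lia.
Qed.

Lemma Fdig_above x y d e : 3 * x + (Fx d - Fx e) = 0 -> 3 * y + (Fy d - Fy e) = 1 ->
  x = 0 /\ ((y = 0 /\ ((val d = 0%N /\ val e = 1%N) \/ (val d = 1%N /\ val e = 2%N)))
    \/ (y = 1 /\ val d = 2%N /\ val e = 0%N)).
Proof. by move: d e; do 2![apply: dcase]; rewrite /Fx /Fy /= => hx hy; lia. Qed.

(** Parents of neighbouring cells can be side by side only when the children are diagonal
    neighbours. The last two cases record this, because it cannot happen on two consecutive
    levels. *)
Lemma Fdig_near x y d e :
  `|3 * x + (Fx d - Fx e)| <= 1 -> `|3 * y + (Fy d - Fy e)| <= 1 ->
  (x = 0 /\ `|y| <= 1) \/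
  (x = 1 /\ y = 0 /\ 3 * x + (Fx d - Fx e) = 1 /\ 3 * y + (Fy d - Fy e) = -1) \/
  (x = -1 /\ y = 0 /\ 3 * x + (Fx d - Fx e) = -1 /\ 3 * y + (Fy d - Fy e) = 1).
Proof. by move: d e; do 2![apply: dcase]; rewrite /Fx /Fy /= => hx hy; lia. Qed.

Lemma Edig_eq x y d e : 3 * x + (Ex d - Ex e) = 0 -> 3 * y + (Ey d - Ey e) = 0 ->
  [/\ x = 0, y = 0 & d = e].
Proof.
by move: d e; do 2![apply: dcase]; rewrite /Ex /Ey /= => hx hy; try lia; split => //; lia.
Qed.

Lemma Edig_left x y d e : 3 * x + (Ex d - Ex e) = -1 -> 3 * y + (Ey d - Ey e) = 0 ->
  y = 0 /\ ((x = 0 /\ ((val d = 0%N /\ val e = 1%N) \/ (val d = 1%N /\ val e = 2%N)))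
    \/ (x = -1 /\ val d = 2%N /\ val e = 0%N)).
Proof. by move: d e; do 2![apply: dcase]; rewrite /Ex /Ey /= => hx hy; lia. Qed.

Lemma Edig_below x y d e : 3 * x + (Ex d - Ex e) = 0 -> 3 * y + (Ey d - Ey e) = -1 ->
  x = 0 /\ ((y = 0 /\ val d = 2%N /\ val e = 3%N)
    \/ (y = -1 /\ val d = 4%N /\ val e = 1%N)).
Proof. by move: d e; do 2![apply: dcase]; rewrite /Ex /Ey /= => hx hy; lia. Qed.

Lemma Edig_below2 x y d e : 3 * x + (Ex d - Ex e) = 0 -> 3 * y + (Ey d - Ey e) = -2 ->
  val d = 1%N \/ val d = 3%N.
Proof. by move: d e; do 2![apply: dcase]; rewrite /Ex /Ey /= => hx hy; lia. Qed.

(** The restrictions to digits below 4 matter because only digit 4 is ever exchanged: such a child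
    still lies in the square of its own parent. *)
Lemma Edig_near x y d e :
  `|3 * x + (Ex d - Ex e)| <= 1 -> `|3 * y + (Ey d - Ey e)| <= 1 ->
  (x = 0 /\ y = 0) \/
  (`|x| = 1 /\ y = 0 /\ (val d < 4)%N /\ (val e < 4)%N) \/
  (x = 0 /\ y = 1 /\ (val d < 4)%N) \/ (x = 0 /\ y = -1 /\ (val e < 4)%N).
Proof. by move: d e; do 2![apply: dcase]; rewrite /Ex /Ey /= => hx hy; lia. Qed.

End DigitGeometry.

(** * Relative positions of two cells of the same level *)

Section Lattice.
Implicit Types (a b : nat -> 'I_5) (s t : state).

Fixpoint run s a n : state :=
  if n is m.+1 then next (run s a m) (a m) else s.

Definition Fxs a k := Fx (a k).
Definition Fys a k := Fy (a k).
Definition Exs a k := Ex (a k).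
(** An exchange moves a subcell by a whole parent cell, that is, by three rows of subcells. *)
Definition Eys s a k := Ey (a k) + 3 * swap (run s a k) (a k).

(** For a stream of digits this is the coordinate of the level [n] cell in units of [3 ^- n]. *)
Fixpoint lat (u : nat -> int) n : int :=
  if n is m.+1 then 3 * lat u m + u m else 0.

(* What the positions of two cells of the same level say about their images:
   [p] and [q] are the differences of the positions in [F] and in [E]. *)
Record linked s t (px py qx qy : int) : Prop := Linked {
  linkedF : px = 0 -> py = 0 -> [/\ s = t, qx = 0 & qy = 0];
  linkedE : qx = 0 -> qy = 0 -> [/\ s = t, px = 0 & py = 0];
  linked_above : px = 0 -> py = 1 -> qx = -1 /\ qy = 0;
  linked_left : qx = -1 -> qy = 0 -> px = 0 /\ py = 1;
  linked_below : qx = 0 -> qy = -1 ->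
    s = Lower /\ t = Upper /\ px = 1 /\ py = 0;
  linked_below2 : s = Lower -> qx = 0 -> qy <> -2 }.

(* An integer copy of the state, for the benefit of [lia]. *)
Let code s : int := match s with Single => 0 | Lower => 1 | Upper => 2 end.

Let codeE s t px py qx qy : linked s t px py qx qy -> qx = 0 ->
  [/\ qy = 0 -> code s = code t, qy = -1 -> code s = 1 /\ code t = 2 &
      code s = 1 -> qy <> -2].
Proof.
move=> h x0; split.
- by move=> /(linkedE h x0)[->].
- by move=> /(linked_below h x0)[-> [-> _]].
- by move=> s1; apply: (linked_below2 h _ x0); case: s s1 h.
Qed.

Lemma swap_lt4 s d : (val d < 4)%N -> swap s d = 0.
Proof. by case: d => [[|[|[|[|[|]]]]] ?]. Qed.

(** The relation is chosen so as to be inductive. Its fields are oriented, so both orders of the two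
    cells are assumed. The field [linked_below2] keeps the square above a pair empty, which makes
    room for the exchanged top subcell. *)
Lemma linked_next s t px py qx qy d e :
  linked s t px py qx qy -> linked t s (- px) (- py) (- qx) (- qy) ->
  linked (next s d) (next t e)
    (3 * px + (Fx d - Fx e)) (3 * py + (Fy d - Fy e))
    (3 * qx + (Ex d - Ex e)) (3 * (qy + (swap s d - swap t e)) + (Ey d - Ey e)).
Proof.
have dig (u : 'I_5) m (um : val u = m) (m5 : (m < 5)%N) : u = Ordinal m5.
  by apply: val_inj.
move=> h k; split.
- move=> /Fdig_eq /[apply] -[x0 y0 ->].
  by have [-> -> ->] := linkedF h x0 y0; split=> //; lia.
- move=> /Edig_eq /[apply] -[x0 y0 de]; subst e.
  suff [st q0] : s = t /\ qy = 0.
    by have [_ -> ->] := linkedE h x0 q0; rewrite st; split=> //; lia.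
  have [d4|d4] := ltnP (val d) 4.
    move: y0; rewrite !swap_lt4 // subrr addr0 => y0.
    by have [] := linkedE h x0 y0.
  have {}d4 : val d = 4%N by apply/eqP; rewrite eqn_leq d4 -ltnS ltn_ord.
  rewrite (dig _ _ d4 isT) /swap /= in y0.
  (* For digit 4 the two swaps would have to compensate [qy]; the fields on cells one and two rows
     apart, in both orders, leave only equal states. *)
  have nx0 : - qx = 0 by lia.
  have := codeE h x0; have := codeE k nx0.
  by case: s t {h k} y0 => -[] /= y0 [? ? ?] [? ? ?]; split=> //; lia.
- move=> /Fdig_above /[apply] -[x0 [[y0 hd]|[y1 [hd he]]]].
    have [-> -> ->] := linkedF h x0 y0.
    by case: hd => -[hd he];
      rewrite (dig _ _ hd isT) (dig _ _ he isT) /Ex /Ey /swap /=; lia.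
  have [-> ->] := linked_above h x0 y1.
  by rewrite (dig _ _ hd isT) (dig _ _ he isT) /Ex /Ey /swap /=; lia.
- move=> /Edig_left /[apply] -[y0 [[x0 hd]|[x1 [hd he]]]].
    have sw : swap s d = 0 /\ swap t e = 0.
      by case: hd => -[hd he]; rewrite !swap_lt4 ?hd ?he.
    rewrite sw.1 sw.2 subrr addr0 in y0.
    have [_ -> ->] := linkedE h x0 y0.
    by case: hd => -[hd he]; rewrite (dig _ _ hd isT) (dig _ _ he isT) /Fx /Fy /=; lia.
  rewrite !swap_lt4 ?hd ?he // subrr addr0 in y0.
  have [-> ->] := linked_left h x1 y0.
  by rewrite (dig _ _ hd isT) (dig _ _ he isT) /Fx /Fy /=; lia.
- move=> /Edig_below /[apply] -[x0 [[y0 [hd he]]|[y1 [hd he]]]].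
    rewrite !swap_lt4 ?hd ?he // subrr addr0 in y0.
    have [-> -> ->] := linkedE h x0 y0.
    rewrite (dig _ _ hd isT) (dig _ _ he isT) /Fx /Fy /=.
    by case: t {h k} => //=; do !split => //; lia.
  (* Here a subcell 4 lies just under a subcell 1. Only [s = Upper] survives, and then the two are
     subcells of one and the same cell, digits 4 and 1 being side by side in [F]. *)
  rewrite (@swap_lt4 t e) ?he // subr0 in y1.
  rewrite (dig _ _ hd isT) (dig _ _ he isT) /swap /= in y1 *.
  have := linkedE h x0; have := codeE h x0; rewrite /Fx /Fy {h k} /=.
  case: s t y1 => -[] /= y1 [? ? ?] h2; try by exfalso; lia.
  have qy0 : qy = 0 by lia.
  by have [_ -> ->] := h2 qy0.
(* Digits 1 and 3 never lead to the state [Lower]. *)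
- move=> sL /Edig_below2 /[apply] -[] hd; move: sL; rewrite (dig _ _ hd isT);
    by case: s {h k}.
Qed.

Lemma linked_run a b n : linked (run Single a n) (run Single b n)
  (lat (Fxs a) n - lat (Fxs b) n) (lat (Fys a) n - lat (Fys b) n)
  (lat (Exs a) n - lat (Exs b) n)
  (lat (Eys Single a) n - lat (Eys Single b) n).
Proof.
elim: n a b => [|n IHn] a b; first by split=> //=; lia.
have E m u v : lat u m.+1 - lat v m.+1 = 3 * (lat u m - lat v m) + (u m - v m).
  by rewrite /=; lia.
rewrite !E; have := linked_next (a n) (b n) (IHn a b);
  rewrite !opprB => /(_ (IHn b a)) /=.
by congr linked; rewrite /Eys; lia.
Qed.

Lemma lat_inj a b n : lat (Fxs a) n = lat (Fxs b) n ->
  lat (Fys a) n = lat (Fys b) n -> forall k, (k < n)%N -> a k = b k.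
Proof.
elim: n => // n IHn /= hx hy k.
have [||x0 y0 ab] := @Fdig_eq (lat (Fxs a) n - lat (Fxs b) n)
  (lat (Fys a) n - lat (Fys b) n) (a n) (b n); [by rewrite /Fxs in hx *; lia|
  by rewrite /Fys in hy *; lia|].
rewrite ltnS leq_eqVlt => /predU1P[->//|]; apply: IHn; lia.
Qed.

(** Two levels are lost. One step up, the cells may be side by side, but then they are not diagonal
    neighbours, so the second step puts them in the same column. *)
Lemma lat_Fnear a b n :
  `|lat (Fxs a) n.+2 - lat (Fxs b) n.+2| <= 1 ->
  `|lat (Fys a) n.+2 - lat (Fys b) n.+2| <= 1 ->
  lat (Fxs a) n = lat (Fxs b) n /\ `|lat (Fys a) n - lat (Fys b) n| <= 1.
Proof.
have E m u v : lat u m.+1 - lat v m.+1 = 3 * (lat u m - lat v m) + (u m - v m).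
  by rewrite /=; lia.
rewrite E (E n.+1 (Fys a)) => /Fdig_near /[apply] h.
have {}h : (lat (Fxs a) n.+1 - lat (Fxs b) n.+1 = 0 /\
    `|lat (Fys a) n.+1 - lat (Fys b) n.+1| <= 1) \/
   (`|lat (Fxs a) n.+1 - lat (Fxs b) n.+1| = 1 /\
    lat (Fys a) n.+1 - lat (Fys b) n.+1 = 0) by lia.
have := @Fdig_near (lat (Fxs a) n - lat (Fxs b) n)
  (lat (Fys a) n - lat (Fys b) n) (a n) (b n).
by rewrite -[Fx (a n)]/(Fxs a n) -[Fx (b n)]/(Fxs b n)
   -[Fy (a n)]/(Fys a n) -[Fy (b n)]/(Fys b n) -!E; lia.
Qed.

Lemma lat_FnearE a b n :
  lat (Fxs a) n = lat (Fxs b) n -> `|lat (Fys a) n - lat (Fys b) n| <= 1 ->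
  `|lat (Exs a) n - lat (Exs b) n| <= 1 /\
  lat (Eys Single a) n = lat (Eys Single b) n.
Proof.
move=> hx hy; have h := linked_run a b n; have k := linked_run b a n.
have hx0 : lat (Fxs a) n - lat (Fxs b) n = 0 by lia.
have kx0 : lat (Fxs b) n - lat (Fxs a) n = 0 by lia.
have := linked_above h hx0; have := linked_above k kx0.
suff : lat (Fys a) n - lat (Fys b) n = 0 ->
  lat (Exs a) n - lat (Exs b) n = 0 /\ lat (Eys Single a) n - lat (Eys Single b) n = 0
    by lia.
by move=> /(linkedF h hx0)[].
Qed.

(** The alternatives say that, after the exchange, the two subcells lie in the same square or in
    stacked squares. Either way their parents in the coding are equal or form a pair, and the
    members of a pair are horizontal neighbours in [F]. *)
Let linked_swap s t px py qx qy d e :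
  linked s t px py qx qy -> linked t s (- px) (- py) (- qx) (- qy) ->
  qx = 0 ->
  (qy + (swap s d - swap t e) = 0 \/ qy + swap s d = -1 \/ qy - swap t e = 1) ->
  `|px| <= 1 /\ py = 0.
Proof.
move=> h k x0 H.
suff : qy = 0 \/ qy = -1 \/ - qy = -1.
  have x0' : - qx = 0 by lia.
  case=> [/(linkedE h x0)[_ -> ->]|[|]]; first by lia.
    by move=> /(linked_below h x0)[_ [_ [-> ->]]].
  by move=> /(linked_below k x0')[_ [_ []]]; lia.
have x0' : - qx = 0 by lia.
have [h1 h2 h3] := codeE h x0; have [k1 k2 k3] := codeE k x0'.
have swapP u c : swap u c = 0 \/ code u = 1 /\ swap u c = 1 \/
                                code u = 2 /\ swap u c = -1.
  by case: u; case: c => [[|[|[|[|[|]]]]] ?]; rewrite /swap /=; lia.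
move: (swapP s d) (swapP t e) => {swapP h k}.
by case=> [s0|[[s1 s2]|[s1 s2]]] [t0|[[t1 t2]|[t1 t2]]]; lia.
Qed.

Lemma lat_Enear a b n :
  `|lat (Exs a) n.+1 - lat (Exs b) n.+1| <= 1 ->
  `|lat (Eys Single a) n.+1 - lat (Eys Single b) n.+1| <= 1 ->
  `|lat (Fxs a) n - lat (Fxs b) n| <= 1 /\ `|lat (Fys a) n - lat (Fys b) n| <= 1.
Proof.
have h := linked_run a b n.
have k : linked (run Single b n) (run Single a n)
  (- (lat (Fxs a) n - lat (Fxs b) n)) (- (lat (Fys a) n - lat (Fys b) n))
  (- (lat (Exs a) n - lat (Exs b) n))
  (- (lat (Eys Single a) n - lat (Eys Single b) n)).
  by rewrite !opprB; exact: linked_run.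
have -> : lat (Exs a) n.+1 - lat (Exs b) n.+1 =
  3 * (lat (Exs a) n - lat (Exs b) n) + (Ex (a n) - Ex (b n)).
  by rewrite /= /Exs; lia.
have -> : lat (Eys Single a) n.+1 - lat (Eys Single b) n.+1 =
  3 * (lat (Eys Single a) n - lat (Eys Single b) n +
       (swap (run Single a n) (a n) - swap (run Single b n) (b n)))
  + (Ey (a n) - Ey (b n)).
  by rewrite /= /Eys; lia.
move: h k; move: (run _ a n) (run _ b n) (a n) (b n) => s t d e.
move: (lat (Fxs a) n - _) (lat (Fys a) n - _) (lat (Exs a) n - _)
  (lat (Eys _ a) n - _) => px py qx qy h k /Edig_near /[apply].
case=> [[x0 y0]|[[x1 [y0 [da db]]]|H]].
- by have [|-> ->] := @linked_swap s t px py qx qy d e h k x0; [left|].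
- rewrite !swap_lt4 // in y0.
  have [qx1|qx1] : qx = -1 \/ - qx = -1 by lia.
    by have := linked_left h qx1; lia.
  by have := linked_left k qx1; lia.
- have x0 : qx = 0 by case: H => -[].
  have [|-> ->] := @linked_swap s t px py qx qy d e h k x0; last by [].
  by case: H => [[_ [y0 d4]]|[_ [y0 d4]]]; rewrite (swap_lt4 _ d4) in y0;
      right; [right|left]; lia.
Qed.
Lemma eq_lat u v n : (forall k, (k < n)%N -> u k = v k) -> lat u n = lat v n.
Proof.
elim: n => //= n IHn uv; rewrite uv // IHn // => k kn.
by apply: uv; rewrite ltnS ltnW.
Qed.

Lemma eq_run s a b n : (forall k, (k < n)%N -> a k = b k) ->
  run s a n = run s b n.
Proof.
elim: n => //= n IHn ab; rewrite ab // IHn // => k kn.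
by apply: ab; rewrite ltnS ltnW.
Qed.

Let replace a n d k := if k == n then d else a k.

Let replace_lt a n d k : (k < n)%N -> replace a n d k = a k.
Proof. by rewrite /replace; case: eqP => // ->; rewrite ltnn. Qed.

Let replaceE a n d : [/\
  lat (Fxs (replace a n d)) n.+1 = lat (Fxs a) n.+1 + (Fx d - Fx (a n)),
  lat (Fys (replace a n d)) n.+1 = lat (Fys a) n.+1 + (Fy d - Fy (a n)),
  lat (Exs (replace a n d)) n.+1 = lat (Exs a) n.+1 + (Ex d - Ex (a n)) &
  lat (Eys Single (replace a n d)) n.+1 = lat (Eys Single a) n.+1 +
    (Ey d - Ey (a n)) + 3 * (swap (run Single a n) d - swap (run Single a n) (a n))].
Proof.
have E u v x : (forall k, (k < n)%N -> u k = v k) -> u n = v n + x ->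
    lat u n.+1 = lat v n.+1 + x.
  by move=> /= uv ->; rewrite (eq_lat uv) addrA.
have R m : (m <= n)%N -> run Single (replace a n d) m = run Single a m.
  by move=> mn; apply: eq_run => k /leq_trans/(_ mn); exact: replace_lt.
have rn : replace a n d n = d by rewrite /replace eqxx.
split; try (apply: E; rewrite /Fxs /Fys /Exs ?rn; last lia;
  by move=> k kn; rewrite replace_lt).
rewrite -addrA; apply: E => [k kn|]; rewrite /Eys.
  by rewrite replace_lt // R // ltnW.
by rewrite rn R //; lia.
Qed.

(** The partner differs in the last digit only: a pair consists of digits 2 and 3 of any cell, or of
    digits 4 and 1 of an [Upper] cell. *)
Lemma partner_Lower a n : run Single a n = Lower -> exists b,
  [/\ lat (Fxs b) n = lat (Fxs a) n - 1, lat (Fys b) n = lat (Fys a) n,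
      lat (Exs b) n = lat (Exs a) n &
      lat (Eys Single b) n = lat (Eys Single a) n + 1].
Proof.
case: n => //= n aL.
have [[an]|[an sU]] : a n = @Ordinal 5 2 isT \/
    a n = @Ordinal 5 4 isT /\ run Single a n = Upper.
  case: (run Single a n) aL; case: (a n) => [[|[|[|[|[|]]]]] ?] //= _;
    by [left; exact: val_inj|right; split=> //; exact: val_inj].
- exists (replace a n (@Ordinal 5 3 isT)); case: (replaceE a n (@Ordinal 5 3 isT)).
  by rewrite an /Fx /Fy /Ex /Ey /swap /= => -> -> -> ->; split; lia.
- exists (replace a n (@Ordinal 5 1 isT)); case: (replaceE a n (@Ordinal 5 1 isT)).
  by rewrite an sU /Fx /Fy /Ex /Ey /swap /= => -> -> -> ->; split; lia.
Qed.

Lemma partner_Upper a n : run Single a n = Upper -> exists b,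
  [/\ lat (Fxs b) n = lat (Fxs a) n + 1, lat (Fys b) n = lat (Fys a) n,
      lat (Exs b) n = lat (Exs a) n &
      lat (Eys Single b) n = lat (Eys Single a) n - 1].
Proof.
case: n => //= n aU.
have [[an]|[an sU]] : a n = @Ordinal 5 3 isT \/
    a n = @Ordinal 5 1 isT /\ run Single a n = Upper.
  case: (run Single a n) aU; case: (a n) => [[|[|[|[|[|]]]]] ?] //= _;
    by [left; exact: val_inj|right; split=> //; exact: val_inj].
- exists (replace a n (@Ordinal 5 2 isT)); case: (replaceE a n (@Ordinal 5 2 isT)).
  by rewrite an /Fx /Fy /Ex /Ey /swap /= => -> -> -> ->; split; lia.
- exists (replace a n (@Ordinal 5 4 isT)); case: (replaceE a n (@Ordinal 5 4 isT)).
  by rewrite an sU /Fx /Fy /Ex /Ey /swap /= => -> -> -> ->; split; lia.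
Qed.

End Lattice.

(** * Hausdorff measures in the plane *)

Section PlaneDistance.
Variable R : realType.
Implicit Types x y z : R[i].

Lemma cdist_ge0 x y : 0 <= cdist x y.
Proof. by rewrite /cdist; case: (x - y) => a b; exact: sqrtr_ge0. Qed.

Lemma cdistxx x : cdist x x = 0.
Proof. by rewrite /cdist subrr Normc.normc0. Qed.

Lemma cdistC x y : cdist x y = cdist y x.
Proof. by rewrite /cdist -normcN opprB. Qed.

Lemma cdist_triangle y x z : cdist x z <= cdist x y + cdist y z.
Proof. by rewrite /cdist; rewrite -(subrKA y x); exact: le_normcD. Qed.

Lemma cdist_third x y d : cdist (3^-1 * (x + d)) (3^-1 * (y + d)) = 3^-1 * cdist x y.
Proof.
rewrite /cdist -mulrBr opprD addrACA subrr addr0 Normc.normcM Normc.normcV;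
  congr (_^-1 * _).
rewrite /Normc.normc;
  have -> : (3 : R[i]) = ((3 : R) +i* (0 : R))%C by rewrite -[LHS](rmorph_nat
  (real_complex R)).
by rewrite expr0n addr0 sqrtr_sqr ger0_norm.
Qed.

Lemma Re_le_cdist (a b c d : R) : `|a - c| <= cdist (a +i* b)%C (c +i* d)%C.
Proof.
rewrite /cdist /=; rewrite -sqrtr_sqr ler_wsqrtr // lerDl; exact: sqr_ge0.
Qed.

Lemma Im_le_cdist (a b c d : R) : `|b - d| <= cdist (a +i* b)%C (c +i* d)%C.
Proof.
rewrite /cdist /=; rewrite -sqrtr_sqr ler_wsqrtr // lerDr; exact: sqr_ge0.
Qed.

Lemma cdist_le_ReIm (a b c d : R) :
  cdist (a +i* b)%C (c +i* d)%C <= `|a - c| + `|b - d|.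
Proof.
rewrite /cdist /= -[leRHS]ger0_norm ?addr_ge0 // -sqrtr_sqr ler_wsqrtr //.
rewrite -[(a - c) ^+ 2]real_normK ?num_real // -[(b - d) ^+ 2]real_normK ?num_real //.
by have := normr_ge0 (a - c); have := normr_ge0 (b - d); nra.
Qed.

End PlaneDistance.

Section Diameter.
Variable R : realType.
Implicit Types (A B U : set R[i]) (s t d r : R).

Lemma le_cdist_diam A x y : A x -> A y -> ((cdist x y)%:E <= diam A)%E.
Proof. by move=> Ax Ay; apply: ereal_sup_ubound; right; exists x => //; exists y. Qed.

Lemma diam_ge0 A : (0 <= diam A)%E.
Proof. by apply: ereal_sup_ubound; left. Qed.

Lemma diam_le A (r : \bar R) : (0 <= r)%E ->
  (forall x y, A x -> A y -> ((cdist x y)%:E <= r)%E) -> (diam A <= r)%E.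
Proof.
move=> r0 Ar; apply: ge_ereal_sup => _ [->//|[x Ax [y Ay <-]]]; exact: Ar.
Qed.

Lemma diam_set0 : diam (set0 : set R[i]) = 0%E.
Proof.
apply/eqP; rewrite eq_le diam_ge0 andbT; exact: diam_le.
Qed.

Lemma diam_set1 x : diam [set x : R[i]] = 0%E.
Proof.
apply/eqP; rewrite eq_le diam_ge0 andbT; apply: diam_le => // _ _ -> ->.
by rewrite cdistxx.
Qed.

Lemma le_diam A B : A `<=` B -> (diam A <= diam B)%E.
Proof.
move=> AB; apply: diam_le => [|x y /AB Bx /AB By]; first exact: diam_ge0.
exact: le_cdist_diam.
Qed.

Lemma diam_pow_ge0 s U : (0 <= diam_pow s U)%E.
Proof. by rewrite /diam_pow; case: ifP => // _; exact: poweR_ge0. Qed.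

Lemma diam_pow_set0 s : diam_pow s (set0 : set R[i]) = 0%E.
Proof. by rewrite /diam_pow eqxx. Qed.

Lemma diam_pow_fin s U d : U !=set0 -> (diam U <= d%:E)%E ->
  diam_pow s U = ((fine (diam U)) `^ s)%:E.
Proof.
move=> /set0P/negPf U0 Ud; rewrite /diam_pow U0 -poweR_EFin fineK //.
by rewrite ge0_fin_numE ?diam_ge0 // (le_lt_trans Ud) // ltry.
Qed.

Lemma diam_pow_le_image (f : R[i] -> R[i]) L s U : 0 <= L -> 0 <= s ->
  (forall x y, U x -> U y -> cdist (f x) (f y) <= L * cdist x y) ->
  (diam_pow s (f @` U) <= (L `^ s)%:E * diam_pow s U)%E.
Proof.
move=> L0 s0 fL; rewrite /diam_pow.
have [->|/set0P U0] := eqVneq U set0; first by rewrite image_set0 eqxx mule0.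
case: ifPn => _; first by rewrite mule_ge0 ?poweR_ge0 ?lee_fin ?powR_ge0.
rewrite -poweR_EFin -poweRM ?lee_fin ?diam_ge0 //.
apply: gt0_ler_poweR => //; rewrite ?in_itv /= ?diam_ge0 ?leey //.
  by rewrite mule_ge0 ?diam_ge0.
apply: diam_le => [|_ _ [x Ux <-] [y Uy <-]]; first by rewrite mule_ge0 ?diam_ge0.
rewrite (@le_trans _ _ (L * cdist x y)%:E) ?lee_fin ?fL //.
by rewrite EFinM lee_pmul // ?lee_fin ?cdist_ge0 // le_cdist_diam.
Qed.

Lemma le_image_diam (f : R[i] -> R[i]) L U : 0 <= L ->
  (forall x y, U x -> U y -> cdist (f x) (f y) <= L * cdist x y) ->
  (diam (f @` U) <= L%:E * diam U)%E.
Proof.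
move=> L0 fL; apply: diam_le => [|_ _ [x Ux <-] [y Uy <-]].
  by rewrite mule_ge0 ?diam_ge0.
rewrite (@le_trans _ _ (L * cdist x y)%:E) ?lee_fin ?fL //.
by rewrite EFinM lee_pmul // ?lee_fin ?cdist_ge0 // le_cdist_diam.
Qed.

Lemma diam_pow_exponent s t d U : 0 <= s <= t -> 0 <= d -> (diam U <= d%:E)%E ->
  (diam_pow t U <= (d `^ (t - s))%:E * diam_pow s U)%E.
Proof.
move=> /andP[s0 st] d0 Ud; have [->|/set0P U0] := eqVneq U set0.
  by rewrite !diam_pow_set0 mule0.
rewrite !(diam_pow_fin _ U0 Ud) -EFinM lee_fin.
have : 0 <= fine (diam U) <= d.
  rewrite fine_ge0 ?diam_ge0 //= -lee_fin fineK //.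
  by rewrite ge0_fin_numE ?diam_ge0 // (le_lt_trans Ud) // ltry.
move: (fine _) => x /andP[x0 xd].
have [->|xn0] := eqVneq x 0.
  have [t0|t0] := eqVneq t 0.
    have -> : s = 0 by apply/eqP; rewrite eq_le s0 -t0 st.
    by rewrite t0 subrr !powRr0 mulr1.
  by rewrite (powR0 t0) mulr_ge0 ?powR_ge0.
rewrite -{1}(subrK s t) (@powRD _ x); last by apply/implyP=> _; exact: xn0.
rewrite ler_wpM2r ?powR_ge0 // ge0_ler_powR ?nnegrE ?subr_ge0 //.
Qed.

End Diameter.

(* The plane with every set declared measurable, so that the Method I
   construction [mu_ext] of the library applies to arbitrary covers. *)
Definition discrete_plane (R : realType) : Type := R[i].

Section HausdorffOuterMeasure.
Variable R : realType.

HB.instance Definition _ := Choice.on (discrete_plane R).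
HB.instance Definition _ := Pointed.on (discrete_plane R).
HB.instance Definition _ := @isMeasurable.Build default_measure_display
  (discrete_plane R) discrete_measurable discrete_measurable0
  discrete_measurableC discrete_measurableU.

Implicit Types (A B U : set R[i]) (s t d r : R).

(** The value [+oo] makes covers by sets of diameter above [d] useless for the infimum, so the bound
    on diameters becomes part of the set function and countable subadditivity comes from
    [mu_ext]. *)
Let gauge s d (U : set (discrete_plane R)) : \bar R :=
  if (diam U <= d%:E)%E then diam_pow s U else +oo%E.

Let gauge_ge0 s d U : (0 <= gauge s d U)%E.
Proof. by rewrite /gauge; case: ifP => // _; exact: diam_pow_ge0. Qed.

Let gauge0 s d : 0 <= d -> gauge s d set0 = 0%E.
Proof. by move=> d0; rewrite /gauge diam_set0 lee_fin d0 diam_pow_set0. Qed.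

Let contentE s d : 0 <= d -> hausdorff_content s d = mu_ext (gauge s d).
Proof.
move=> d0; apply/funext => A; apply/eqP; rewrite eq_le; apply/andP; split.
- apply: le_ereal_inf_tmp => _ [U [_ AU] <-].
  have [Ud|/existsNP[n Un]] := pselect (forall n, (diam (U n) <= d%:E)%E).
    apply: ereal_inf_lbound; exists U => //; apply: eq_eseriesr => n _.
    by rewrite /gauge Ud.
  rewrite (@eseries_pinfty _ _ _ n) ?leey //.
    by move=> m _; rewrite -ltNye (lt_le_trans _ (gauge_ge0 _ _ _)).
  by rewrite /gauge ifF //; apply/negP.
- apply: le_ereal_inf_tmp => _ [U [AU Ud] <-]; apply: ereal_inf_lbound.
  by exists U => //; apply: eq_eseriesr => n _; rewrite /gauge Ud.
Qed.

(* Stated for [d > 0] as a type so that it can be an instance. *)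
Definition pos_content s (d : {posnum R}) : set R[i] -> \bar R :=
  hausdorff_content s d%:num.

Lemma le_content s d : {homo hausdorff_content s d : A B / A `<=` B >-> (A <= B)%E}.
Proof.
move=> A B AB; apply: ereal_inf_le_tmp => _ [U [BU Ud] <-].
by exists U => //; split=> //; exact: subset_trans BU.
Qed.

Lemma content_ge0 s d A : (0 <= hausdorff_content s d A)%E.
Proof.
by apply: le_ereal_inf_tmp => _ [U _ <-]; apply: nneseries_ge0 => n _ _;
  exact: diam_pow_ge0.
Qed.

Let pos_content0 s (d : {posnum R}) : pos_content s d set0 = 0%E.
Proof. by rewrite /pos_content contentE // mu_ext0 // gauge0. Qed.

Let pos_content_sigma s (d : {posnum R}) : sigma_subadditive (pos_content s d).
Proof.
move=> A; rewrite /pos_content contentE //; exact: mu_ext_sigma_subadditive.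
Qed.

HB.instance Definition _ s (d : {posnum R}) := isOuterMeasure.Build R R[i] (pos_content
  s d)
  (pos_content0 s d) (content_ge0 s d%:num) (@le_content s d%:num)
  (@pos_content_sigma s d).

Lemma content_le_measure s d A : 0 < d ->
  (hausdorff_content s d A <= hausdorff_measure s A)%E.
Proof. by move=> d0; apply: ereal_sup_ubound; exists d. Qed.

Lemma hausdorff_measure_ge0 s A : (0 <= hausdorff_measure s A)%E.
Proof. exact: le_trans (content_ge0 s 1 A) (content_le_measure _ _ ltr01). Qed.

Lemma hausdorff_measure_le s A (x : \bar R) :
  (forall d : {posnum R}, (pos_content s d A <= x)%E) -> (hausdorff_measure s A <= x)%E.
Proof. by move=> h; apply: ge_ereal_sup => _ [d /= d0 <-]; exact: (h (PosNum d0)). Qed.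

Lemma le_hausdorff_measure s :
  {homo @hausdorff_measure R s : A B / A `<=` B >-> (A <= B)%E}.
Proof.
move=> A B AB; apply: hausdorff_measure_le => d.
apply: (le_trans (@le_content s d%:num _ _ AB)); exact: content_le_measure.
Qed.

Let hausdorff_measure0 s : hausdorff_measure s (set0 : set R[i]) = 0%E.
Proof.
apply/eqP; rewrite eq_le hausdorff_measure_ge0 andbT.
by apply: hausdorff_measure_le => d; rewrite outer_measure0.
Qed.

Let hausdorff_measure_sigma s : sigma_subadditive (@hausdorff_measure R s).
Proof.
move=> A; apply: hausdorff_measure_le => d.
apply: le_trans (outer_measure_sigma_subadditive _ _) _.
by apply: lee_nneseries => n _ //; exact: content_le_measure.
Qed.

HB.instance Definition _ s := isOuterMeasure.Build R R[i] (hausdorff_measure s)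
  (hausdorff_measure0 s) (hausdorff_measure_ge0 s) (@le_hausdorff_measure s)
  (@hausdorff_measure_sigma s).

Lemma content_image s d L (f : R[i] -> R[i]) A : 0 < L -> 0 <= s ->
  (forall x y, A x -> A y -> cdist (f x) (f y) <= L * cdist x y) ->
  (hausdorff_content s (L * d) (f @` A) <= (L `^ s)%:E * hausdorff_content s d A)%E.
Proof.
move=> L0 s0 fL; rewrite -ereal_inf_pZl ?powR_gt0 //.
apply: le_ereal_inf_tmp => _ [_ [U [AU Ud] <-] <-].
(* The Lipschitz bound holds on [A] only, so the cover is first cut down to [A]. *)
have fU n x y : (U n `&` A) x -> (U n `&` A) y -> cdist (f x) (f y) <= L * cdist x y.
  by move=> [_ Ax] [_ Ay]; exact: fL.
apply: (@le_trans _ _ (\sum_(0 <= n <oo) diam_pow s (f @` (U n `&` A)))%E).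
  apply: ereal_inf_lbound; exists (fun n => f @` (U n `&` A)) => //; split.
    by move=> _ [x Ax <-]; have [n _ Un] := AU x Ax; exists n => //; exists x.
  move=> n; apply: le_trans (le_image_diam (ltW L0) (fU n)) _.
  rewrite EFinM lee_pmul2l // ?lte_fin //; apply: le_trans (Ud n).
  by apply: le_diam; exact: subIsetl.
rewrite -nneseriesZl; last by move=> n _; exact: diam_pow_ge0.
apply: lee_nneseries => [n _ _|n _]; first exact: diam_pow_ge0.
apply: le_trans (diam_pow_le_image (ltW L0) s0 (fU n)) _.
rewrite lee_pmul2l ?lte_fin ?powR_gt0 // /diam_pow.
have [_|/set0P I0] := eqVneq (U n `&` A) set0.
  by case: ifP => // _; exact: poweR_ge0.
case: ifPn => [/eqP U0|_]; first by case: I0 => x []; rewrite U0.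
apply: gt0_ler_poweR => //; rewrite ?in_itv /= ?diam_ge0 ?leey //.
by apply: le_diam; exact: subIsetl.
Qed.

Lemma hausdorff_measure_image s L (f : R[i] -> R[i]) A : 0 < L -> 0 <= s ->
  (forall x y, A x -> A y -> cdist (f x) (f y) <= L * cdist x y) ->
  (hausdorff_measure s (f @` A) <= (L `^ s)%:E * hausdorff_measure s A)%E.
Proof.
move=> L0 s0 fL; apply: hausdorff_measure_le => d.
have -> : pos_content s d (f @` A) = hausdorff_content s (L * (L^-1 * d%:num)) (f @` A).
  by rewrite mulVKf ?gt_eqF.
apply: le_trans (content_image _ L0 s0 fL) _.
by rewrite lee_pmul2l ?lte_fin ?powR_gt0 // content_le_measure // mulr_gt0 ?invr_gt0.
Qed.

Lemma content_exponent s t d A : 0 <= s <= t -> 0 < d ->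
  (hausdorff_content t d A <= (d `^ (t - s))%:E * hausdorff_content s d A)%E.
Proof.
move=> st d0; rewrite -ereal_inf_pZl ?powR_gt0 //.
apply: le_ereal_inf_tmp => _ [_ [U [AU Ud] <-] <-].
apply: (@le_trans _ _ (\sum_(0 <= n <oo) diam_pow t (U n))%E).
  by apply: ereal_inf_lbound; exists U.
rewrite -nneseriesZl; last by move=> n _; exact: diam_pow_ge0.
apply: lee_nneseries => [n _ _|n _]; first exact: diam_pow_ge0.
exact: diam_pow_exponent st (ltW d0) (Ud n).
Qed.

Lemma le_content_delta s d e A : d <= e ->
  (hausdorff_content s e A <= hausdorff_content s d A)%E.
Proof.
move=> de; apply: ereal_inf_le_tmp => _ [U [AU Ud] <-]; exists U => //; split=> // n.
by rewrite (le_trans (Ud n)) // lee_fin.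
Qed.

Lemma hausdorff_measure_eq0 s t A : 0 <= s <= t ->
  hausdorff_measure s A = 0%E -> hausdorff_measure t A = 0%E.
Proof.
move=> st A0; apply/eqP; rewrite eq_le hausdorff_measure_ge0 andbT.
apply: hausdorff_measure_le => d; apply: le_trans (content_exponent _ st _) _ => //.
have -> : hausdorff_content s d%:num A = 0%E; last by rewrite mule0.
by apply/eqP; rewrite eq_le content_ge0 andbT -A0 content_le_measure.
Qed.

Lemma hausdorff_measure_above s t A : 0 <= s < t ->
  (hausdorff_measure s A < +oo)%E -> hausdorff_measure t A = 0%E.
Proof.
move=> /andP[s0 st] Afin; apply/eqP; rewrite eq_le hausdorff_measure_ge0 andbT.
apply: hausdorff_measure_le => d; apply/lee_addgt0Pr => e e0; rewrite add0e.
set h := fine (hausdorff_measure s A).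
have hE : hausdorff_measure s A = h%:E.
  by rewrite fineK // ge0_fin_numE ?hausdorff_measure_ge0.
have h0 : 0 <= h by rewrite -lee_fin -hE hausdorff_measure_ge0.
(* Chosen so that [r] to the power [t - s] times [h + 1] is [e]; adding 1 covers the case
   [h = 0]. *)
pose r := (e / (h + 1)) `^ (t - s)^-1.
have ts0 : 0 < t - s by rewrite subr_gt0.
have h10 : 0 < h + 1 by rewrite ltr_wpDl.
have r0 : 0 < r by rewrite powR_gt0 // divr_gt0.
pose m := Num.min r d%:num.
have m0 : 0 < m by rewrite lt_min r0 /=.
have md : m <= d%:num by rewrite ge_min lexx orbT.
apply: le_trans (le_content_delta _ _ md) _.
have sm : 0 <= s <= t by rewrite s0 ltW.
apply: le_trans (content_exponent _ sm m0) _.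
apply: (@le_trans _ _ ((r `^ (t - s))%:E * h%:E)%E).
  rewrite lee_pmul ?lee_fin ?powR_ge0 ?content_ge0 //.
    apply: ge0_ler_powR; rewrite ?nnegrE ?(ltW m0) ?(ltW r0) ?(ltW ts0) //.
    by rewrite ge_min lexx.
  by rewrite -hE content_le_measure.
rewrite -EFinM lee_fin /r -powRrM mulVf ?gt_eqF // powRr1 ?divr_ge0 ?(ltW e0) ?(ltW
  h10) //.
rewrite mulrAC ler_pdivrMr // ler_wpM2l ?(ltW e0) //; lra.
Qed.

Lemma hausdorff_dim_eq s A : 0 <= s -> hausdorff_measure s A != 0%E ->
  (hausdorff_measure s A < +oo)%E -> hausdorff_dim A = s%:E.
Proof.
move=> s0 A0 Afin; apply/eqP; rewrite eq_le; apply/andP; split.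
- apply/lee_addgt0Pr => e e0; apply: ereal_inf_lbound; exists (s + e) => //.
  split; first by rewrite addr_ge0 // (ltW e0).
  by apply: (hausdorff_measure_above _ Afin); rewrite s0 ltrDl.
- apply: le_ereal_inf_tmp => _ [t [t0 At] <-]; rewrite lee_fin leNgt.
  apply: contra A0 => ts; apply/eqP.
  by apply: (hausdorff_measure_eq0 _ At); rewrite t0 ltW.
Qed.

Lemma hausdorff_measure_countable s A : 0 < s -> countable A ->
  hausdorff_measure s A = 0%E.
Proof.
move=> s0 cA; have /pcard_surjP[g Ag] := cA; apply/eqP;
  rewrite eq_le hausdorff_measure_ge0 andbT.
apply: hausdorff_measure_le => d.
have gA : A `<=` \bigcup_n [set g n] by move=> x /Ag[n _ <-]; exists n.
apply: ereal_inf_lbound => /=; exists (fun n => [set g n]); first split=> //.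
  by move=> n; rewrite diam_set1.
apply: eseries0 => n _ _; rewrite /diam_pow diam_set1 poweR0r ?if_same //.
by rewrite gt_eqF.
Qed.

End HausdorffOuterMeasure.

(** * Base 5 digits and Lebesgue measure *)

Section PentadicCoding.
Variable R : realType.
Implicit Types (a b : nat -> 'I_5) (t : R).

Definition cylinder a n : set (nat -> 'I_5) := [set b | forall k, (k < n)%N -> b k = a k].

Fixpoint word a n : nat := if n is m.+1 then (5 * word a m + a m)%N else 0%N.

Definition digits t (k : nat) : 'I_5 := inord (Num.truncn (5 ^+ k.+1 * t) %% 5).

Lemma word_inj a b n : word a n = word b n -> cylinder b n a.
Proof.
elim: n => // n IHn /= e k; rewrite ltnS.
have := ltn_ord (a n); have := ltn_ord (b n) => bn an.
have [ew ed] : word a n = word b n /\ a n = b n :> nat by lia.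
rewrite leq_eqVlt => /predU1P[->|kn]; first exact: val_inj.
exact: IHn.
Qed.

Lemma eq_word a b n : cylinder b n a -> word a n = word b n.
Proof.
elim: n => //= n IHn ab; rewrite ab // IHn // => k kn.
by apply: ab; rewrite ltnS ltnW.
Qed.

Lemma word_digits t n : 0 <= t < 1 -> word (digits t) n = Num.truncn (5 ^+ n * t).
Proof.
move=> /andP[t0 t1]; elim: n => [|n IHn] /=.
  by rewrite expr0 mul1r; apply/esym/truncn_def; rewrite t0.
rewrite IHn /digits inordK ?ltn_mod // mulnC.
have x0 m : 0 <= 5 ^+ m * t :> R by rewrite mulr_ge0 ?exprn_ge0.
suff -> : Num.truncn (5 ^+ n * t) = (Num.truncn (5 ^+ n.+1 * t) %/ 5)%N by rewrite
  -divn_eq.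
apply: truncn_def; have /andP[l u] := truncn_itv (x0 n.+1).
have := ltn_pmod (Num.truncn (5 ^+ n.+1 * t)) (isT : (0 < 5)%N).
have : (Num.truncn (5 ^+ n.+1 * t))%:R = (Num.truncn (5 ^+ n.+1 * t) %/ 5)%:R * 5
    + (Num.truncn (5 ^+ n.+1 * t) %% 5)%:R :> R.
  by rewrite -natrM -natrD -divn_eq.
move: l u; rewrite -!natr1; move: (Num.truncn _) => N; rewrite exprS -mulrA => l u e r5.
have : (N %% 5)%:R <= 4 :> R by rewrite ler_nat.
have : 0 <= (N %% 5)%:R :> R by [].
by move=> ? ?; apply/andP; split; lra.
Qed.

(** The candidate [t] is the supremum of the finite base 5 truncations of [a]. Digits obtained by
    truncation can miss [a] only if [t] is the right end of one of its pentadic intervals, and then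
    all later digits are 4. *)
Lemma digits_surj a : (exists2 t, 0 <= t < 1 & digits t = a) \/
  exists n, forall k, (n <= k)%N -> val (a k) = 4%N.
Proof.
pose A : set R := [set (word a n)%:R / 5 ^+ n | n in setT].
have p5 n : 0 < 5 ^+ n :> R by rewrite exprn_gt0.
have word_add n m : (word a (n + m) < 5 ^ m * (word a n).+1)%N.
  elim: m => [|m IHm]; first by rewrite addn0 mul1n.
  rewrite addnS /= expnS -mulnA; have := ltn_ord (a (n + m)%N).
  by move: (5 ^ m * _)%N IHm => x; lia.
have word_mono n m : (5 ^ m * word a n <= word a (n + m))%N.
  elim: m => [|m IHm]; first by rewrite addn0 mul1n.
  by rewrite addnS /= expnS -mulnA; move: (5 ^ m * _)%N IHm => x; lia.
have ubA n : ubound A ((word a n).+1%:R / 5 ^+ n).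
  move=> _ [m _ <-]; rewrite ler_pdivrMr // mulrAC ler_pdivlMr //.
  rewrite -!natrX -!natrM ler_nat; have [mn|/ltnW nm] := leqP m n.
    by rewrite -(subnKC mn) expnD; have := word_mono m (n - m)%N; nia.
  by rewrite -(subnKC nm) expnD; have := word_add n (m - n)%N; nia.
have hA : has_sup A.
  split; first by exists ((word a 0)%:R / 5 ^+ 0), 0%N.
  by exists ((word a 0).+1%:R / 5 ^+ 0); exact: (ubA 0%N).
pose t := sup A.
have tl n : (word a n)%:R <= 5 ^+ n * t.
  rewrite mulrC -ler_pdivrMr //; apply: sup_upper_bound => //; exists n => //.
have tu n : 5 ^+ n * t <= (word a n).+1%:R.
  by rewrite mulrC -ler_pdivlMr //; apply: ge_sup; [case: hA|exact: ubA].
have [tlt|] := pselect (forall n, 5 ^+ n * t < (word a n).+1%:R).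
  left; exists t.
    by have := tl 0%N; have := tlt 0%N; rewrite /= expr0 mul1r => -> ->.
  apply/funext => k; apply: val_inj; rewrite /digits /= inordK ?ltn_mod //.
  have -> : Num.truncn (5 ^+ k.+1 * t) = word a k.+1.
    by apply: truncn_def; rewrite tl tlt.
  by rewrite /= mulnC modnMDl modn_small.
move=> /existsNP[n /negP]; rewrite -leNgt => nt; right; exists n => k nk.
have E m : word a (n + m) = (5 ^ m * (word a n).+1).-1.
  have := word_add n m.
  suff : (5 ^ m * (word a n).+1 <= (word a (n + m)).+1)%N.
    by move=> h1 h2; lia.
  rewrite -(ler_nat R) (le_trans _ (tu _)) // exprD mulrC mulrA natrM natrX.
  by rewrite mulrC ler_pM2l // mulrC.
have := E (k - n).+1; have := E (k - n)%N.
rewrite addnS subnKC //= expnS -mulnA => ->.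
have : (0 < 5 ^ (k - n))%N by rewrite expn_gt0.
have : (5 ^ (k - n) <= 5 ^ (k - n) * (word a n).+1)%N by rewrite leq_pmulr.
move: (5 ^ (k - n) * _)%N => x; have := ltn_ord (a k); lia.
Qed.

End PentadicCoding.

(** * From bounds on cylinders to proportionality with Lebesgue measure *)

Section CylinderBound.
Variables (R : realType) (s H : R) (h : (nat -> 'I_5) -> R[i]).
Hypotheses (s_gt0 : 0 < s) (H_ge0 : 0 <= H).
Hypothesis cylinder_le : forall a n,
  (hausdorff_measure s (h @` cylinder a n) <= (H / 5 ^+ n)%:E)%E.

Local Notation unit_itv := (`[0, 1[%classic : set R).

Let nu (A : set R) : \bar R := hausdorff_measure s (h @` (@digits R @` (A `&` unit_itv))).

Let exp5_small (e : R) : 0 < e -> exists n, H / 5 ^+ n <= e.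
Proof.
move=> e0; exists (Num.truncn (H / e)).+1.
rewrite ler_pdivrMr ?exprn_gt0 // mulrC -ler_pdivrMr //.
apply: le_trans (ltW (truncnS_gt _)) _; move: (Num.truncn _).+1 => n.
by rewrite -natrX ler_nat ltnW // ltn_expl.
Qed.

Let nu_word n k :
  (nu [set t : R | (0 <= t)%R /\ Num.truncn (5 ^+ n * t)%R = k] <= (H / 5 ^+ n)%:E)%E.
Proof.
set A := [set t : R | _].
have [A0|/set0P[t0 [[_ w0] t01]]] := eqVneq (A `&` unit_itv) set0.
  by rewrite /nu A0 !image_set0 outer_measure0 lee_fin divr_ge0 ?exprn_ge0.
apply: le_trans (cylinder_le (digits t0) n).
apply: le_outer_measure => _ [_ [t [[_ wt] t1] <-] <-]; exists (digits t) => //.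
apply: word_inj; move: t01 t1; rewrite /= !in_itv /= => t01 t1.
by rewrite !word_digits // wt w0.
Qed.

(** The interval meets at most [5 ^+ n * (y - x) + 2] pentadic intervals of level [n], and the
    excess [2 * H / 5 ^+ n] vanishes. Intervals open on the left are those in the covers that define
    [lebesgue_measure]. *)
Let nu_itv x y : x <= y -> (nu `]x, y]%classic <= (H * (y - x))%:E)%E.
Proof.
move=> xy; apply/lee_addgt0Pr => e e0.
have [n Hn] := exp5_small (divr_gt0 e0 (ltr0n R 2)).
have p5 : 0 < 5 ^+ n :> R by rewrite exprn_gt0.
set i := Num.truncn (5 ^+ n * x); set j := Num.truncn (5 ^+ n * y).
have ij : (i <= j)%N by rewrite le_truncn // ler_wpM2l // ltW.
have jix : (j - i).+1%:R <= 5 ^+ n * (y - x) + 2 :> R.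
  have [y0|y0] := leP 0 y; last first.
    have -> : j = 0%N.
      apply/eqP; rewrite -leqn0 /j truncn_le_nat (lt_le_trans _ ler01) // pmulr_rlt0 //.
    by rewrite sub0n -[leLHS]add0r lerD ?mulr_ge0 ?subr_ge0 ?(ltW p5) // ler_nat.
  have /andP[lj _] := truncn_itv (mulr_ge0 (ltW p5) y0).
  have ui := truncnS_gt (5 ^+ n * x).
  move: lj ui; rewrite -/i -/j -!natr1 (natrB _ ij) => lj ui.
  rewrite mulrBr; lra.
pose F k := [set t : R | 0 <= t /\ Num.truncn (5 ^+ n * t) = (i + k)%N].
apply: (@le_trans _ _ (\sum_(k < (j - i).+1) nu (F k))%E).
  pose G k := h @` (@digits R @` (F k `&` unit_itv)).
  apply: (le_trans _ (outer_measure_subadditive (hausdorff_measure s) G _)).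
  rewrite -(bigcup_mkord _ G).
  apply: le_outer_measure => _ [_ [t [/= txy t01] <-] <-].
  have /andP[xt ty] : x < t <= y by move: txy; rewrite in_itv.
  have it : (i <= Num.truncn (5 ^+ n * t))%N by rewrite le_truncn // ler_wpM2l ?ltW.
  have tj : (Num.truncn (5 ^+ n * t) <= j)%N by rewrite le_truncn // ler_wpM2l // ltW.
  exists (Num.truncn (5 ^+ n * t) - i)%N => /=; first by rewrite ltnS leq_sub2r.
  exists (digits t) => //; exists t => //; split=> //; split; last by rewrite subnKC.
  by move: t01; rewrite in_itv => /andP[].
apply: (@le_trans _ _ (\sum_(k < (j - i).+1) (H / 5 ^+ n)%:E)%E).
  by apply: lee_sum => k _; exact: nu_word.
rewrite sumEFin big_const_ord iter_addr addr0 lee_fin.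
rewrite -[_ *+ (j - i).+1]mulr_natr.
apply: (@le_trans _ _ (H / 5 ^+ n * (5 ^+ n * (y - x) + 2))).
  by rewrite ler_wpM2l // divr_ge0 // ltW.
rewrite mulrDr lerD //; first by rewrite mulrA divfK ?gt_eqF.
by rewrite -ler_pdivlMr.
Qed.

Lemma hausdorff_measure_digits (A : set R) : A `<=` unit_itv ->
  (hausdorff_measure s (h @` (@digits R @` A)) <= H%:E * lebesgue_measure A)%E.
Proof.
move=> A01; have -> : A = A `&` unit_itv by rewrite setIidl.
change (nu A <= H%:E * lebesgue_measure (A `&` unit_itv))%E.
rewrite setIidl //.
(* Scaling the infimum that defines Lebesgue measure requires [H > 0]; if [H = 0], a single interval
   containing the domain already has image of measure 0. *)
have [H0|H0] := eqVneq H 0.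
  apply: (@le_trans _ _ (nu `]-1, 1]%classic)).
    apply: le_outer_measure => _ [_ [t [At t01] <-] <-]; exists (digits t) => //.
    exists t => //; split=> //; move: t01.
    by rewrite /= !in_itv /= => /andP[? ?]; apply/andP; split; lra.
  by rewrite (le_trans (nu_itv _)) ?H0 ?mul0r ?mul0e //; lra.
have Hpos : 0 < H by rewrite lt_neqAle eq_sym H0.
rewrite -[lebesgue_measure A]/(mu_ext (wlength idfun) A) -ereal_inf_pZl //.
apply: le_ereal_inf_tmp => _ [_ [C [mC AC] <-] <-].
pose G n := h @` (@digits R @` (C n `&` unit_itv)).
apply: (@le_trans _ _ (\sum_(0 <= n <oo) hausdorff_measure s (G n))%E).
  apply: le_trans (outer_measure_sigma_subadditive (hausdorff_measure s) G).
  apply: le_outer_measure => _ [_ [t [At t01] <-] <-]; have [n _ Cn] := AC t At.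
  by exists n => //; exists (digits t) => //; exists t.
rewrite -nneseriesZl; last by move=> n _; exact: wlength_ge0.
apply: lee_nneseries => [n _ _|n _]; first exact: outer_measure_ge0.
have [[x y] _ /esym Cxy] := mC n; rewrite /= in Cxy.
rewrite /G Cxy; have [xy|yx] := leP x y.
  change (nu `]x, y]%classic <= H%:E * wlength idfun `]x, y]%classic)%E.
  by rewrite wlength_itv_bnd // -EFinM nu_itv.
rewrite set_itv_ge ?set0I ?image_set0 ?outer_measure0 ?wlength0 ?mule0 //.
by rewrite bnd_simp -leNgt ltW.
Qed.

Lemma hausdorff_measure_not_digits :
  hausdorff_measure s (h @` [set a | ~ (@digits R @` unit_itv) a]) = 0%E.
Proof.
apply: hausdorff_measure_countable => //.
have sub : h @` [set a | ~ (@digits R @` unit_itv) a] `<=`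
    (* The default value of [nth] supplies the infinite tail of digits 4, so finite words enumerate
       these codes. *)
    range (fun w : seq 'I_5 => h (fun k => nth (inord 4) w k)).
  move=> _ [a na <-]; have [[t t01 ta]|[n an]] := @digits_surj R a.
    by case: na; exists t => //=; rewrite in_itv.
  exists (mkseq a n) => //; congr h; apply/funext => k.
  have [kn|nk] := ltnP k n; first by rewrite nth_mkseq.
  rewrite nth_default ?size_mkseq //; apply: val_inj.
  by rewrite an //= inordK.
apply: (sub_countable (subset_card_le sub)).
by apply: (sub_countable (card_image_le _ _)).
Qed.

Lemma hausdorff_measure_param_le (S : set (nat -> 'I_5)) :
  (hausdorff_measure s (h @` S) <=
   H%:E * lebesgue_measure (unit_itv `&` (@digits R @^-1` S)))%E.
Proof.
set A := unit_itv `&` _; set N := [set a | ~ (@digits R @` unit_itv) a].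
have SAN : h @` S `<=` h @` (@digits R @` A) `|` h @` N.
  move=> _ [a Sa <-]; have [[t t01 ta]|na] := pselect ((@digits R @` unit_itv) a).
    by left; exists a => //; exists t => //; split=> //=; rewrite ta.
  by right; exists a.
apply: (le_trans (le_outer_measure (hausdorff_measure s) _ _ SAN)).
apply: (le_trans (outer_measureU2 (hausdorff_measure s) _ _)).
rewrite -[leRHS]adde0; apply: leeD.
  by apply: hausdorff_measure_digits => t [].
by rewrite le_eqVlt; apply/orP; left; apply/eqP; exact: hausdorff_measure_not_digits.
Qed.

Lemma hausdorff_measure_param (S : set (nat -> 'I_5)) :
  hausdorff_measure s (range h) = H%:E ->
  measurable (unit_itv `&` (@digits R @^-1` S)) ->
  hausdorff_measure s (h @` S) =
    (H%:E * lebesgue_measure (unit_itv `&` (@digits R @^-1` S)))%E.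
Proof.
move=> rangeH mS; have le1 := hausdorff_measure_param_le S.
have le2 := hausdorff_measure_param_le (~` S).
have le3 : (H%:E <= hausdorff_measure s (h @` S) + hausdorff_measure s (h @` (~` S)))%E.
  rewrite -rangeH; apply: le_trans (outer_measureU2 (hausdorff_measure s) _ _).
  by apply: le_outer_measure; rewrite -image_setU setUv.
have mI : measurable unit_itv by exact: measurable_itv.
have leb01 : lebesgue_measure unit_itv = 1%:E :> \bar R.
  by rewrite lebesgue_measure_itv /= lte_fin ltr01 sube0.
have DE : unit_itv `&` (@digits R @^-1` (~` S)) =
    unit_itv `\` (unit_itv `&` (@digits R @^-1` S)).
  by rewrite setDIr setDv set0U.
have lS : (lebesgue_measure (unit_itv `&` (@digits R @^-1` S)) <= 1%:E :> \bar R)%E.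
  by rewrite -leb01 le_measure ?inE // => t [].
have fin1 : (lebesgue_measure unit_itv < +oo :> \bar R)%E by rewrite leb01 ltry.
have lD : lebesgue_measure (unit_itv `\` (unit_itv `&` (@digits R @^-1` S))) =
    (1 - lebesgue_measure (unit_itv `&` (@digits R @^-1` S)))%E.
  rewrite [LHS]measureD //; congr (_ - _)%E; first exact: leb01.
  by rewrite setIA setIid.
have : (0 <= lebesgue_measure (unit_itv `&` (@digits R @^-1` S)) :> \bar R)%E.
  exact: measure_ge0.
move: le1 le2 lS; rewrite DE lD; set X := lebesgue_measure _.
case: X => [x| |] //; rewrite !lee_fin -EFinB -!EFinM => l1 l2 x1 x0.
move: le3 l1 l2; have := hausdorff_measure_ge0 s (h @` S).
have := hausdorff_measure_ge0 s (h @` (~` S)).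
case: (hausdorff_measure _ _) (hausdorff_measure _ _) => [u| |] [v| |] //=;
  rewrite -?EFinD ?lee_fin // => u0 v0 l3 l1 l2.
by congr EFin; nra.
Qed.

End CylinderBound.

(** * Coding maps and their distortion *)

Section TriadicExpansion.
Variable R : realType.
Implicit Types (u v : nat -> int) (x : R).

(* The sum of the [u k / 3 ^ k.+1], obtained from the nested intervals
   [(lat u n -+ 5 / 2) / 3 ^ n]; the digits that occur below are at most [5]. *)
Definition expand u : R := sup [set ((lat u n)%:~R - 5 / 2) / 3 ^+ n | n in setT].

(** The constant [5 / 2] is the sum of all [5 / 3 ^ k.+1], the largest possible tail. *)
Lemma expandP u n : (forall k, `|u k| <= 5) ->
  `|3 ^+ n * expand u - (lat u n)%:~R| <= 5 / 2.
Proof.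
move=> u5; pose lo n : R := ((lat u n)%:~R - 5 / 2) / 3 ^+ n.
pose hi n : R := ((lat u n)%:~R + 5 / 2) / 3 ^+ n.
have p3 m : 0 < 3 ^+ m :> R by rewrite exprn_gt0.
have u5R k : `|(u k)%:~R| <= 5%:~R :> R by rewrite -intr_norm ler_int.
have step m : lo m <= lo m.+1 /\ hi m.+1 <= hi m.
  have q := p3 m; have q0 : 3 ^+ m != 0 :> R by rewrite gt_eqF.
  have := u5R m; rewrite ler_norml => /andP[l1 l2].
  have -> : lo m.+1 = lo m + ((u m)%:~R + 5) / (3 * 3 ^+ m).
    by rewrite /lo /= intrD intrM exprS; field.
  have -> : hi m.+1 = hi m - (5 - (u m)%:~R) / (3 * 3 ^+ m).
    by rewrite /hi /= intrD intrM exprS; field.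
  by split; rewrite ?lerDl ?gerBl divr_ge0 ?mulr_ge0 ?(ltW q) //; lra.
have lo_hi m : lo m <= hi m by rewrite ler_pM2r ?invr_gt0 //; lra.
have lo_mono m k : lo m <= lo (m + k)%N.
  by elim: k => [|k IH]; rewrite ?addn0 // addnS (le_trans IH) // (step _).1.
have hi_mono m k : hi (m + k)%N <= hi m.
  by elim: k => [|k IH]; rewrite ?addn0 // addnS (le_trans _ IH) // (step _).2.
have ub m : ubound [set lo n | n in setT] (hi m).
  move=> _ [k _ <-]; apply: le_trans (lo_mono k m) _.
  by apply: le_trans (lo_hi _) _; rewrite addnC.
have hs : has_sup [set lo n | n in setT].
  by split; [exists (lo 0%N), 0%N|exists (hi 0%N); exact: ub].
have l : lo n <= expand u by apply: sup_upper_bound => //; exists n.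
have h : expand u <= hi n by apply: ge_sup; [case: hs|exact: ub].
move: l h; rewrite /lo /hi ler_pdivrMr // ler_pdivlMr // => l h.
by rewrite mulrC ler_norml; apply/andP; split; lra.
Qed.

Lemma scaled_small x C : (forall n, 3 ^+ n * `|x| <= C) -> x = 0.
Proof.
move=> xC; apply/eqP; rewrite -normr_eq0; apply: contraT => x0.
have {}x0 : 0 < `|x| by rewrite lt_neqAle eq_sym x0 normr_ge0.
have C0 : 0 <= C by have := xC 0%N; rewrite expr0 mul1r; apply: le_trans.
have := xC (Num.truncn (C / `|x|)).+1; rewrite -ler_pdivlMr // leNgt => /negP[].
apply: lt_le_trans (truncnS_gt _) _; move: (Num.truncn _).+1 => n.
by rewrite -natrX ler_nat ltnW // ltn_expl.
Qed.

Lemma expand_unique u x C : (forall k, `|u k| <= 5) ->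
  (forall n, `|3 ^+ n * x - (lat u n)%:~R| <= C) -> x = expand u.
Proof.
move=> u5 xC; apply/eqP; rewrite -subr_eq0; apply/eqP.
apply: (@scaled_small _ (C + 5 / 2)) => n.
have -> : 3 ^+ n * `|x - expand u| = `|3 ^+ n * (x - expand u)|.
  by rewrite normrM [`|3 ^+ n|]ger0_norm // exprn_ge0.
rewrite mulrBr -(subrKA (lat u n)%:~R) (le_trans (ler_normD _ _)) // lerD //.
by rewrite distrC expandP.
Qed.

Lemma lat_add u n m : lat u (n + m) = 3 ^+ m * lat u n + lat (fun k => u (n + k)%N) m.
Proof.
elim: m => [|m IHm]; first by rewrite addn0 addr0 expr0 mul1r.
by rewrite addnS /= IHm exprS; lia.
Qed.

Lemma expand_shift u n : (forall k, `|u k| <= 5) ->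
  3 ^+ n * expand u = (lat u n)%:~R + expand (fun k => u (n + k)%N).
Proof.
move=> u5; apply/eqP; rewrite addrC -subr_eq; apply/eqP.
apply: (@expand_unique _ _ (5 / 2)) => // m.
have := expandP (n + m) u5; rewrite lat_add intrD intrM rmorphXn exprD.
by rewrite mulrBr mulrA [3 ^+ m * 3 ^+ n]mulrC opprD addrA.
Qed.

Lemma expandS u : (forall k, `|u k| <= 5) ->
  expand u = ((u 0%N)%:~R + expand (fun k => u k.+1)) / 3.
Proof.
move=> u5; have := expand_shift 1 u5; rewrite /= mulr0 add0r expr1 => <-.
by rewrite mulrC mulKf.
Qed.

Lemma norm_expand u : (forall k, `|u k| <= 5) -> `|expand u| <= 5 / 2.
Proof. by move=> u5; have := expandP 0 u5; rewrite expr0 mul1r subr0. Qed.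

Lemma eq_expand u v : u =1 v -> expand u = expand v.
Proof. by move=> /funext ->. Qed.

Lemma expand_near u v n : (forall k, `|u k| <= 5) -> (forall k, `|v k| <= 5) ->
  3 ^+ n * `|expand u - expand v| <= `|lat u n - lat v n|%:~R + 5.
Proof.
move=> u5 v5; rewrite -[3 ^+ n]ger0_norm ?exprn_ge0 // -normrM mulrBr.
rewrite !expand_shift // opprD addrACA -intrB intr_norm.
rewrite (le_trans (ler_normD _ _)) // lerD // (le_trans (ler_normB _ _)) //.
by rewrite (le_trans (lerD (norm_expand _) (norm_expand _))) //; lra.
Qed.

Lemma le_approx x y C : (forall m, x <= y + C / 3 ^+ m) -> x <= y.
Proof.
move=> h; rewrite leNgt; apply/negP => yx.
have := @scaled_small (x - y) C; rewrite gtr0_norm ?subr_gt0 // => z.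
suff : x - y = 0 by lra.
by apply: z => n; have := h n; rewrite -lerBlDl ler_pdivlMr ?exprn_gt0 // mulrC.
Qed.

End TriadicExpansion.

(** * Points given by codes, and the two distortion estimates *)

Section Points.
Variable R : realType.
Implicit Types (a b : nat -> 'I_5) (s : state).

Definition Fdigit (d : 'I_5) : R[i] := ((Fx d)%:~R +i* (Fy d)%:~R)%C.
Definition Edigit s (d : 'I_5) : R[i] := ((Ex d)%:~R +i* (Ey d + 3 * swap s d)%:~R)%C.
Definition Fpoint a : R[i] := (expand R (Fxs a) +i* expand R (Fys a))%C.
(** Every starting state is allowed because the tail of a code is read from the state reached so
    far. *)
Definition Epoint s a : R[i] := (expand R (Exs a) +i* expand R (Eys s a))%C.
Definition shift a k : 'I_5 := a k.+1.

Lemma digit_itv (d : 'I_5) :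
  [/\ 0 <= Fx d <= 2, 0 <= Fy d <= 2, 0 <= Ex d <= 2 & 0 <= Ey d <= 2].
Proof. by case: d => [[|[|[|[|[|]]]]] ?]. Qed.

Lemma norm_swap s d : `|swap s d| <= 1.
Proof. by case: s; case: d => [[|[|[|[|[|]]]]] ?]. Qed.

Lemma Fxs_le5 a k : `|Fxs a k| <= 5.
Proof. by rewrite /Fxs; have [? _ _ _] := digit_itv (a k); lia. Qed.
Lemma Fys_le5 a k : `|Fys a k| <= 5.
Proof. by rewrite /Fys; have [_ ? _ _] := digit_itv (a k); lia. Qed.
Lemma Exs_le5 a k : `|Exs a k| <= 5.
Proof. by rewrite /Exs; have [_ _ ? _] := digit_itv (a k); lia. Qed.
Lemma Eys_le5 s a k : `|Eys s a k| <= 5.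
Proof.
rewrite /Eys; have [_ _ _ ?] := digit_itv (a k).
by have := norm_swap (run s a k) (a k); lia.
Qed.

Lemma mulc_third (x y : R) : 3^-1 * (x +i* y)%C = (x / 3 +i* (y / 3))%C.
Proof.
have -> : (3^-1 : R[i]) = (3^-1 : R)%:C%C.
  by rewrite (rmorphV _ _) ?unitfE ?pnatr_eq0 // rmorph_nat.
by apply/eqP; rewrite eq_complex /=; apply/andP; split; apply/eqP; rewrite /=; ring.
Qed.

Lemma run_shift s a n : run s a n.+1 = run (next s (a 0%N)) (shift a) n.
Proof. by elim: n => //= n ->. Qed.

Lemma FpointS a : Fpoint a = 3^-1 * (Fpoint (shift a) + Fdigit (a 0%N)).
Proof.
rewrite /Fpoint (expandS R (Fxs_le5 a)) (expandS R (Fys_le5 a)).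
rewrite [RHS](_ : _ = 3^-1 * ((expand R (Fxs (shift a)) + (Fx (a 0%N))%:~R) +i*
  (expand R (Fys (shift a)) + (Fy (a 0%N))%:~R))%C) // mulc_third.
by congr (_ / 3 +i* (_ / 3))%C; rewrite addrC.
Qed.

Lemma EpointS s a : Epoint s a =
  3^-1 * (Epoint (next s (a 0%N)) (shift a) + Edigit s (a 0%N)).
Proof.
rewrite /Epoint (expandS R (Exs_le5 a)) (expandS R (Eys_le5 s a)).
rewrite [RHS](_ : _ = 3^-1 * ((expand R (Exs (shift a)) + (Ex (a 0%N))%:~R) +i*
  (expand R (Eys (next s (a 0%N)) (shift a)) + (Ey (a 0%N) + 3 * swap s (a
    0%N))%:~R))%C) //.
rewrite mulc_third; congr (_ / 3 +i* (_ / 3))%C; rewrite addrC //.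
by congr (_ + _); apply: eq_expand => k; rewrite /Eys run_shift.
Qed.

Lemma cdist_Fpoint_le a b n : 3 ^+ n * cdist (Fpoint a) (Fpoint b) <=
  (`|lat (Fxs a) n - lat (Fxs b) n| + `|lat (Fys a) n - lat (Fys b) n|)%:~R + 10.
Proof.
apply: le_trans (ler_wpM2l (exprn_ge0 n (ler0n R 3)) (cdist_le_ReIm _ _ _ _)) _.
have := expand_near R n (Fxs_le5 a) (Fxs_le5 b).
by have := expand_near R n (Fys_le5 a) (Fys_le5 b); rewrite mulrDr intrD; lra.
Qed.

Lemma cdist_Epoint_le s t a b n : 3 ^+ n * cdist (Epoint s a) (Epoint t b) <=
  (`|lat (Exs a) n - lat (Exs b) n| + `|lat (Eys s a) n - lat (Eys t b) n|)%:~R + 10.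
Proof.
apply: le_trans (ler_wpM2l (exprn_ge0 n (ler0n R 3)) (cdist_le_ReIm _ _ _ _)) _.
have := expand_near R n (Exs_le5 a) (Exs_le5 b).
by have := expand_near R n (Eys_le5 s a) (Eys_le5 t b); rewrite mulrDr intrD; lra.
Qed.

Lemma expand_itv (u : nat -> int) : (forall k, 0 <= u k <= 2) -> 0 <= expand R u <= 1.
Proof.
move=> u2.
have u5 (v : nat -> int) : (forall k, 0 <= v k <= 2) -> forall k, `|v k| <= 5.
  by move=> v2 k; have := v2 k; lia.
suff h m : - (3 / 3 ^+ m) <= expand R u <= 1 + 3 / 3 ^+ m.
  apply/andP; split; apply: (@le_approx _ _ _ 3) => m; have /andP[] := h m; lra.
elim: m u u2 => [|m IHm] u u2.
  have := norm_expand R (u5 _ u2); rewrite expr0 ler_norml => /andP[? ?].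
  by apply/andP; split; lra.
have /andP[l h] := IHm _ (fun k => u2 k.+1).
have [? ?] : 0 <= (u 0%N)%:~R :> R /\ (u 0%N)%:~R <= 2%:~R :> R.
  by rewrite ler0z ler_int; apply/andP; exact: u2.
rewrite (expandS R (u5 _ u2)) exprS invfM.
by apply/andP; split; lra.
Qed.

(** An exchange can send the point to the square of the partner, above for [Lower] and below for
    [Upper]. The induction is on the precision: reading one digit divides the error [3 / 3 ^+ m] by
    3, and [norm_expand] starts it. *)
Lemma Epoint_itv s a :
  (if s is Upper then -1 else 0) <= expand R (Eys s a) <= (if s is Lower then 2 else 1).
Proof.
suff h m : (if s is Upper then -1 else 0) - 3 / 3 ^+ m <= expand R (Eys s a)
    <= (if s is Lower then 2 else 1) + 3 / 3 ^+ m.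
  move: (if s is Upper then _ else _) (if s is Lower then _ else _) h => lo hi h.
  apply/andP; split; apply: (@le_approx _ _ _ 3) => m; have /andP[] := h m; lra.
elim: m s a => [|m IHm] s a.
  have := norm_expand R (Eys_le5 s a); rewrite expr0 ler_norml.
  by move: (expand _ _) => y /andP[? ?]; case: s; apply/andP; split; lra.
have := IHm (next s (a 0%N)) (shift a).
rewrite (expandS R (Eys_le5 s a)) exprS invfM.
have -> : expand R (fun k => Eys s a k.+1) = expand R (Eys (next s (a 0%N)) (shift a)).
  by apply: eq_expand => k; rewrite /Eys run_shift.
rewrite {1}/Eys /= intrD intrM; move: (expand _ _) => y.
case: (a 0%N) => [[|[|[|[|[|//]]]]] ?]; case: s; rewrite /next /swap /Ey /= => /andP[l h];
  apply/andP; rewrite -?[(-1)%:~R]/(- 1%:~R); split; lra.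
Qed.

Lemma int_near (x y : R) (k l : int) n :
  0 <= 3 ^+ n * x - k%:~R <= 1 -> 0 <= 3 ^+ n * y - l%:~R <= 1 ->
  `|x - y| < (3 ^+ n)^-1 -> `|k - l| <= 1.
Proof.
move=> /andP[x0 x1] /andP[y0 y1].
rewrite -[(_)^-1]mul1r ltr_pdivlMr ?exprn_gt0 // mulrC.
rewrite -[3 ^+ n in X in X -> _]ger0_norm ?exprn_ge0 // -normrM mulrBr ltr_norml =>
  /andP[l1 l2].
suff : `|k - l| < 2 by lia.
by rewrite -(ltr_int R) intr_norm intrB ltr_norml; apply/andP; split; lra.
Qed.

Lemma expand_cell (u : nat -> int) n : (forall k, 0 <= u k <= 2) ->
  0 <= 3 ^+ n * expand R u - (lat u n)%:~R <= 1.
Proof.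
move=> u2; rewrite expand_shift; last by move=> k; have := u2 k; lia.
by rewrite addrC addKr; apply: expand_itv => k; exact: u2.
Qed.

Lemma Fpoint_sep a b n : cdist (Fpoint a) (Fpoint b) < (3 ^+ n)^-1 ->
  `|lat (Fxs a) n - lat (Fxs b) n| <= 1 /\ `|lat (Fys a) n - lat (Fys b) n| <= 1.
Proof.
move=> ab; split; apply: int_near; try (apply: expand_cell => k;
   by have [] := digit_itv (a k); have [] := digit_itv (b k)).
- exact: le_lt_trans (Re_le_cdist _ _ _ _) ab.
- exact: le_lt_trans (Im_le_cdist _ _ _ _) ab.
Qed.

(* The point lies in the square of [a] or in that of its partner. *)
Lemma Epoint_cell a n : exists b,
  [/\ `|lat (Fxs a) n - lat (Fxs b) n| <= 1, lat (Fys a) n = lat (Fys b) n,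
    0 <= 3 ^+ n * expand R (Exs a) - (lat (Exs b) n)%:~R <= 1 &
    0 <= 3 ^+ n * expand R (Eys Single a) - (lat (Eys Single b) n)%:~R <= 1].
Proof.
have hx : 0 <= 3 ^+ n * expand R (Exs a) - (lat (Exs a) n)%:~R <= 1.
  by apply: expand_cell => k; have [] := digit_itv (a k).
have : (if run Single a n is Upper then -1 else 0) <=
    3 ^+ n * expand R (Eys Single a) - (lat (Eys Single a) n)%:~R <=
    (if run Single a n is Lower then 2 else 1).
  rewrite expand_shift; last exact: Eys_le5.
  rewrite addrC addKr; have := Epoint_itv (run Single a n) (fun k => a (n + k)%N).
  have -> // : expand R (Eys (run Single a n) (fun k => a (n + k)%N)) =
    expand R (fun k => Eys Single a (n + k)%N).
  apply: eq_expand => k; rewrite /Eys; congr (_ + 3 * swap _ _).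
  by elim: k => [|k IHk]; rewrite ?addn0 // addnS /= IHk.
case rE : (run Single a n) => /andP[l u].
- by exists a; split=> //; [lia|apply/andP; split].
- have [h|h] := leP (3 ^+ n * expand R (Eys Single a) - (lat (Eys Single a) n)%:~R) 1.
    by exists a; split=> //; [lia|apply/andP; split].
  have [b [bx by' bX bY]] := partner_Lower rE; exists b; split.
  + by rewrite bx; lia.
  + by rewrite by'.
  + by rewrite bX.
  + by rewrite bY intrD; apply/andP; split; lra.
- have [h|h] := leP 0 (3 ^+ n * expand R (Eys Single a) - (lat (Eys Single a) n)%:~R).
    by exists a; split=> //; [lia|apply/andP; split].
  have [b [bx by' bX bY]] := partner_Upper rE; exists b; split.
  + by rewrite bx; lia.
  + by rewrite by'.
  + by rewrite bX.
  + by rewrite bY intrB; apply/andP; split; lra.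
Qed.

Let Fpos_next a b n :
  `|lat (Fxs a) n - lat (Fxs b) n| <= 1 -> `|lat (Fys a) n - lat (Fys b) n| <= 1 ->
  `|lat (Fxs a) n.+1 - lat (Fxs b) n.+1| <= 5 /\
  `|lat (Fys a) n.+1 - lat (Fys b) n.+1| <= 5.
Proof.
have [u1 u2 _ _] := digit_itv (a n); have [v1 v2 _ _] := digit_itv (b n).
rewrite /= -[Fxs a n]/(Fx (a n)) -[Fys a n]/(Fy (a n)).
rewrite -[Fxs b n]/(Fx (b n)) -[Fys b n]/(Fy (b n)).
by move: (Fx _) (Fy _) (Fx _) (Fy _) u1 u2 v1 v2 => *; lia.
Qed.

(** The exponent [n.+2] pays for the two levels lost in [lat_Fnear]. The cells of [E] are then in
    the same row and at most one column apart, whence [1 + 10 <= 12]. *)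
Lemma near_Fpoint_Epoint a b n :
  cdist (Fpoint a) (Fpoint b) < (3 ^+ n.+2)^-1 ->
  cdist (Epoint Single a) (Epoint Single b) <= 12 / 3 ^+ n.
Proof.
move=> /Fpoint_sep[hx hy]; have [px py] := lat_Fnear hx hy.
have [qx qy] := lat_FnearE px py.
rewrite ler_pdivlMr ?exprn_gt0 // mulrC (le_trans (cdist_Epoint_le _ _ _ _ n)) //.
rewrite qy subrr normr0 addr0; move: qx; rewrite -(ler_int R) => qx; lra.
Qed.

(** The points may lie in the squares of the partners [a'] and [b'], so it is these that are
    compared. Back in [F], differences of at most 1 at level [n] become at most [3 + 2] at level
    [n.+1], and each partner adds at most 1 to the horizontal one: [7 + 5 = 12], and
    [12 + 10 <= 3 * 12]. *)
Lemma near_Epoint_Fpoint a b n :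
  cdist (Epoint Single a) (Epoint Single b) < (3 ^+ n.+1)^-1 ->
  cdist (Fpoint a) (Fpoint b) <= 12 / 3 ^+ n.
Proof.
move=> ab; have [a' [ax ay aX aY]] := Epoint_cell a n.+1.
have [b' [bx by' bX bY]] := Epoint_cell b n.+1.
have hX := int_near aX bX (le_lt_trans (Re_le_cdist _ _ _ _) ab).
have hY := int_near aY bY (le_lt_trans (Im_le_cdist _ _ _ _) ab).
have [px py] := lat_Enear hX hY.
have [dx dy] := Fpos_next px py.
have hF : `|lat (Fxs a) n.+1 - lat (Fxs b) n.+1| + `|lat (Fys a) n.+1 - lat (Fys b)
  n.+1| <= 12.
  move: dx dy ax ay bx by' {ab aX aY bX bY hX hY px py}.
  move: (lat (Fxs a) _) (lat (Fys a) _) (lat (Fxs b) _) (lat (Fys b) _).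
  move: (lat (Fxs a') _) (lat (Fys a') _) (lat (Fxs b') _) (lat (Fys b') _).
  by move=> ? ? ? ? ? ? ? ? ? ? ? ? ? ?; lia.
have := cdist_Fpoint_le a b n.+1; move: hF; rewrite -(ler_int R) => hF h.
rewrite ler_pdivlMr ?exprn_gt0 // mulrC -(ler_pM2l (ltr0n R 3)) mulrA -exprS.
by lra.
Qed.

End Points.

(** * The attractors as ranges of the coding maps *)

Section PlaneTopology.
Variable R : realType.
Implicit Types (x y : R[i]).

Lemma ball_cdist x y (e : R) : 0 < e -> ball x e%:C%C y = (cdist x y < e) :> Prop.
Proof.
move=> e0; rewrite -ball_normE /=; congr is_true.
by rewrite -[RHS]ltcR.
Qed.

Lemma nbhs_cdist x (e : R) : 0 < e -> nbhs x [set y | cdist x y < e].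
Proof.
move=> e0; apply/nbhs_ballP; exists e%:C%C => /=; first by rewrite ltcR.
by move=> y; rewrite ball_cdist.
Qed.

Lemma open_cdist (U : set R[i]) x : open U -> U x ->
  exists2 e : R, 0 < e & forall y, cdist x y < e -> U y.
Proof.
move=> oU Ux; have /nbhs_ballP[[e i] /=] := open_nbhs_nbhs (conj oU Ux).
rewrite ltcE /= => /andP[/eqP i0 e0] xU; subst i; exists e => // y xy.
by apply: xU; rewrite (ball_cdist x y e0).
Qed.

Lemma compact_seq (K : set R[i]) (u : nat -> R[i]) : compact K -> (forall n, K (u n)) ->
  exists2 y, K y & forall (e : R) n, 0 < e -> exists2 m, (n <= m)%N & cdist (u m) y < e.
Proof.
move=> cK Ku; have [|y [Ky cy]] := cK (u @ \oo) _.
  by exists 0%N => // n _; exact: Ku.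
exists y => // e n e0.
have [|_ [[m nm <-] ym]] := cy (u @` [set m | (n <= m)%N]) [set z | cdist y z < e] _
  (nbhs_cdist y e0).
  by exists n => // m nm; exists m.
by exists m => //; rewrite cdistC.
Qed.

Lemma compact_bound (K : set R[i]) : compact K ->
  exists M : R, forall x, K x -> cdist x 0 <= M.
Proof.
move=> cK; apply: contrapT => /forallNP h.
have {h}/choice[u Ku] : forall n : nat, exists x, K x /\ n%:R < cdist x 0.
  move=> n; have /existsNP[x /not_implyP[Kx /negP]] := h n%:R.
  by rewrite -ltNge => ?; exists x.
have [y Ky yu] := compact_seq cK (fun n => (Ku n).1).
have [m nm] := yu 1 (Num.truncn (cdist y 0 + 1)).+1 ltr01.
apply/negP; rewrite -leNgt.
have [_ h1] := Ku m; have h2 := truncnS_gt (cdist y 0 + 1).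
have h3 : (Num.truncn (cdist y 0 + 1)).+1%:R <= m%:R :> R by rewrite ler_nat.
have h4 := cdist_triangle y (u m) 0; move: h1 h2 h3 h4.
by lra.
Qed.

Lemma compact_limit (K : set R[i]) x : compact K ->
  (forall e : R, 0 < e -> exists2 y, K y & cdist y x < e) -> K x.
Proof.
move=> cK h; have /choice[u Ku] : forall n : nat, exists y, K y /\ cdist y x < n.+1%:R^-1.
  by move=> n; have [|y Ky yx] := h n.+1%:R^-1; [rewrite invr_gt0|exists y].
have [y Ky yu] := compact_seq cK (fun n => (Ku n).1).
suff <- : y = x by [].
suff : cdist y x = 0.
  by rewrite /cdist => /Normc.eq0_normc/eqP; rewrite subr_eq0 => /eqP.
apply/eqP; rewrite eq_le cdist_ge0 andbT; apply/ler_addgt0Pr => e e0; rewrite add0r.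
have e20 : 0 < e / 2 by rewrite divr_gt0.
have [m nm um] := yu _ (Num.truncn (e / 2)^-1) e20.
apply: le_trans (cdist_triangle (u m) _ _) _; rewrite cdistC.
have [_ h1] := Ku m.
suff /(lt_trans h1) h2 : m.+1%:R^-1 < e / 2 by rewrite [leRHS](splitr e) lerD // ltW.
rewrite invf_plt ?posrE // (lt_le_trans (truncnS_gt _)) // ler_nat ltnS //.
Qed.

End PlaneTopology.

(** * Recursive structure of [E] on single and stacked copies *)

Section Attractors.
Variable R : realType.
Implicit Types (a : nat -> 'I_5) (s : state) (x y z : R[i]) (A : set R[i]).

Let c (x y : R) : R[i] := (x +i* y)%C.
Let T z d : R[i] := 3^-1 * (z + d).

Let cD (x y x' y' : R) : c x y + c x' y' = c (x + x') (y + y').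
Proof. by []. Qed.

Let nat_c (n : nat) : n%:R = c n%:R 0 :> R[i].
Proof. by rewrite /c -[LHS](rmorph_nat (real_complex R)). Qed.

Let T_shift z (x y : R) : T z (c x y) + c 0 1 = T z (c x (y + 3)).
Proof.
have -> : c x (y + 3) = c x y + 3 * c 0 1.
  by rewrite (nat_c 3) /c; apply/eqP; rewrite eq_complex /=; apply/andP; split;
    apply/eqP; ring.
by rewrite /T; field.
Qed.

Let T_add z (x y : R) : T (z + c 0 1) (c x y) = T z (c x (y + 1)).
Proof. by rewrite /T -addrA cD add0r [1 + y]addrC. Qed.

(** Both members of a pair are described from the lower square; with this shift their points lie in
    the union of [E] and its translate by the imaginary unit. *)
Definition offset s : R[i] := if s is Upper then (0 +i* 1)%C else 0.

(** Translation parts once offsets are absorbed. Digits 1 and 4 of [Upper] share [c 1 2] because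
    together they fill one stacked pair, astride the two squares; likewise digits 2 and 3 of each
    state. *)
Let move s (d : 'I_5) : R[i] :=
  nth 0 (match s with
         | Single => [:: c 0 0; c 1 0; c 2 0; c 2 0; c 1 2]
         | Lower => [:: c 0 0; c 1 0; c 2 0; c 2 0; c 1 5]
         | Upper => [:: c 0 3; c 1 2; c 2 3; c 2 3; c 1 2]
         end) d.

Let Epoint_step s a : Epoint R s a + offset s =
  T (Epoint R (next s (a 0%N)) (shift a) + offset (next s (a 0%N))) (move s (a 0%N)).
Proof.
have -> : move s (a 0%N) = Edigit R s (a 0%N) - offset (next s (a 0%N)) + 3 * offset s.
  rewrite (nat_c 3) /offset /move /Edigit.
  case: (a 0%N) => [[|[|[|[|[|//]]]]] ?]; case: s; rewrite /next /swap /Ex /Ey /c /=;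
    apply/eqP; rewrite eq_complex /=; apply/andP; split; apply/eqP; ring.
by rewrite EpointS /T; field.
Qed.

Let cdist_T x y d : cdist (T x d) (T y d) = 3^-1 * cdist x y.
Proof. exact: cdist_third. Qed.

Let prefix (d : 'I_5) a : nat -> 'I_5 := fun k => if k is m.+1 then a m else d.

Section Approximation.
Variables (A : set R[i]) (M : R).
Let B := A `|` [set z + c 0 1 | z in A].
Hypothesis A0 : A !=set0.
Hypothesis AM : forall s a z, B z -> cdist z (Epoint R s a + offset s) <= M.
Hypothesis AE : A = third_sum A (digitsE R).

Let AT z (x y : R) : c x y \in digitsE R -> A z -> A (T z (c x y)).
Proof. by move=> d Az; rewrite AE; exists z => //; exists (c x y). Qed.

Let AI z : A z -> B (z + c 0 1).
Proof. by move=> Az; right; exists z. Qed.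

Let near n s z := exists a, cdist z (Epoint R s a + offset s) <= M / 3 ^+ n.

Let near_step n s d z : near n (next s d) z -> near n.+1 s (T z (move s d)).
Proof.
move=> [a za]; exists (prefix d a); rewrite Epoint_step cdist_T exprS invfM mulrCA.
by rewrite ler_pM2l // invr_gt0.
Qed.

Let digitsE_c : digitsE R = [:: c 0 0; c 1 0; c 2 0; c 2 1; c 1 2].
Proof. by rewrite /digitsE (nat_c 2). Qed.

(** Up to the factor 3, [A] splits into three copies of [A] and one of [B], and [B] into four copies
    of [A] and three of [B]. The new pair is at [c 1 2]: the top piece of the lower copy together
    with piece 1 of the upper copy. *)
Let A_near n : (forall z, A z -> near n Single z) /\
  (forall z, B z -> near n Lower z \/ near n Upper z).
Proof.
pose d0 := @Ordinal 5 0 isT; pose d1 := @Ordinal 5 1 isT; pose d2 := @Ordinal 5 2 isT.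
pose d3 := @Ordinal 5 3 isT; pose d4 := @Ordinal 5 4 isT.
elim: n => [|n [IHA IHB]].
  have n0 s z : B z -> near 0 s z.
    by move=> Bz; exists (fun=> d0); rewrite expr0 divr1; exact: AM.
  by split=> z Az; [apply: n0; left|left; exact: n0].
have N00 z : A z -> near n.+1 Single (T z (c 0 0)) by move=> /IHA/(@near_step _ Single
  d0).
have N10 z : A z -> near n.+1 Single (T z (c 1 0)) by move=> /IHA/(@near_step _ Single
  d1).
have N12 z : A z -> near n.+1 Single (T z (c 1 2)) by move=> /IHA/(@near_step _ Single
  d4).
have N20 z : B z -> near n.+1 Single (T z (c 2 0)).
  by move=> /IHB[/(@near_step _ Single d2)|/(@near_step _ Single d3)].
pose nearB z := near n.+1 Lower z \/ near n.+1 Upper z.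
have B00 z : A z -> nearB (T z (c 0 0)) by move=> /IHA/(@near_step _ Lower d0); left.
have B10 z : A z -> nearB (T z (c 1 0)) by move=> /IHA/(@near_step _ Lower d1); left.
have B15 z : A z -> nearB (T z (c 1 5)) by move=> /IHA/(@near_step _ Lower d4); left.
have B03 z : A z -> nearB (T z (c 0 3)) by move=> /IHA/(@near_step _ Upper d0); right.
have B20 z : B z -> nearB (T z (c 2 0)).
  by move=> /IHB[/(@near_step _ Lower d2)|/(@near_step _ Lower d3)]; left.
have B23 z : B z -> nearB (T z (c 2 3)).
  by move=> /IHB[/(@near_step _ Upper d2)|/(@near_step _ Upper d3)]; right.
have B12 z : B z -> nearB (T z (c 1 2)).
  by move=> /IHB[/(@near_step _ Upper d4)|/(@near_step _ Upper d1)]; right.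
have AB z : A z -> B z by left.
split=> z.
- rewrite AE digitsE_c => -[w Aw [d + <-]]; rewrite /= !inE.
  rewrite -[3^-1 * (w + d)]/(T w d).
  case/or4P => [/eqP->|/eqP->|/eqP->|/orP[/eqP->|/eqP->]].
  + exact: N00. + exact: N10. + exact/N20/AB.
  + by rewrite -[X in c 2 X]add0r -T_add; exact/N20/AI.
  + exact: N12.
- case=> [|[z' + <-]]; rewrite AE digitsE_c => -[w Aw [d + <-]]; rewrite /= !inE.
    rewrite -[3^-1 * (w + d)]/(T w d) -/(nearB _).
    case/or4P => [/eqP->|/eqP->|/eqP->|/orP[/eqP->|/eqP->]].
    + exact: B00. + exact: B10. + exact/B20/AB.
    + by rewrite -[X in c 2 X]add0r -T_add; exact/B20/AI.
    + exact/B12/AB.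
  rewrite -[3^-1 * (w + d)]/(T w d) -/(nearB _).
  case/or4P => [/eqP->|/eqP->|/eqP->|/orP[/eqP->|/eqP->]]; rewrite T_shift.
  + by rewrite add0r; exact: B03.
  + have -> : 0 + 3 = 2 + 1 :> R by ring.
    by rewrite -T_add; exact/B12/AI.
  + by rewrite add0r; exact/B23/AB.
  + by rewrite addrC -T_add; exact/B23/AI.
  + have -> : 2 + 3 = 5 :> R by ring.
    exact: B15.
Qed.

Let near_A n s a : exists2 z, (if s is Single then A else B) z &
  cdist z (Epoint R s a + offset s) <= M / 3 ^+ n.
Proof.
elim: n s a => [|n IHn] s a.
  have [z Az] := A0; exists z; first by case: s => //; left.
  by rewrite expr0 divr1; apply: AM; left.
have [z Az zn] := IHn (next s (a 0%N)) (shift a).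
exists (T z (move s (a 0%N))); last first.
  by rewrite Epoint_step cdist_T exprS invfM mulrCA ler_pM2l // invr_gt0.
have A00 w : A w -> A (T w (c 0 0)) by apply: AT; rewrite digitsE_c !inE eqxx ?orbT.
have A10 w : A w -> A (T w (c 1 0)) by apply: AT; rewrite digitsE_c !inE eqxx ?orbT.
have A12 w : A w -> A (T w (c 1 2)) by apply: AT; rewrite digitsE_c !inE eqxx ?orbT.
have A20 w : B w -> A (T w (c 2 0)).
  case=> [|[v Av <-]]; first by apply: AT; rewrite digitsE_c !inE eqxx ?orbT.
  by rewrite T_add add0r; apply: AT => //; rewrite digitsE_c !inE eqxx ?orbT.
have B15 w : A w -> B (T w (c 1 5)).
  have -> : 5 = 2 + 3 :> R by ring.
  rewrite -T_shift; by move=> /A12/AI.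
have B03 w : A w -> B (T w (c 0 3)).
  by rewrite -[X in c 0 X]add0r -T_shift => /A00/AI.
have B23 w : B w -> B (T w (c 2 3)).
  by rewrite -[X in c 2 X]add0r -T_shift => /A20/AI.
have B12 w : B w -> B (T w (c 1 2)).
  case=> [/A12|[v Av <-]]; first by left.
  rewrite T_add; have -> : 2 + 1 = 0 + 3 :> R by ring.
  by rewrite -T_shift; exact/AI/A10.
have AB w : A w -> B w by left.
move: Az; case: (a 0%N) => [[|[|[|[|[|//]]]]] ?]; case: s {zn}; rewrite /next /move /=;
  by [exact: A00|exact: A10|exact: A12|exact: A20|exact: B15|exact: B03|exact:
    B23|exact: B12
  |move=> /A00/AB|move=> /A10/AB|move=> /A20/AB].
Qed.

Lemma E_near_Epoint n z : A z -> exists a, cdist z (Epoint R Single a) <= M / 3 ^+ n.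
Proof. by move=> /((A_near n).1)[a]; rewrite addr0; exists a. Qed.

Lemma Epoint_near_E n a : exists2 z, A z & cdist z (Epoint R Single a) <= M / 3 ^+ n.
Proof. by have [z Az] := near_A n Single a; rewrite addr0; exists z. Qed.

End Approximation.

End Attractors.

(** * Hausdorff measures of the attractors *)

Section Scales.
Variable R : realType.
Implicit Types (x y C s : R).

Lemma scale_power x y C s : 0 < s -> 0 <= x -> 0 <= C -> y <= C ->
  (forall n, x < (3 ^+ n.+2)^-1 -> y <= C / (3 ^+ n) `^ s) ->
  y <= C * 27 `^ s * x `^ s.
Proof.
move=> s0 x0 C0 yC h; have [xz|xz] := eqVneq x 0.
  rewrite xz powR0 ?gt_eqF // mulr0 leNgt; apply/negP => y0.
  have K0 : 0 <= C / y by rewrite divr_ge0 // ltW.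
  pose n := (Num.truncn ((C / y) `^ s^-1)).+1.
  have : (C / y) `^ s^-1 < 3 ^+ n.
    by rewrite (lt_le_trans (truncnS_gt _)) // -/n -natrX ler_nat ltnW // ltn_expl.
  move=> /(gt0_ltr_powR s0 _ _) -/(_ (powR_ge0 _ _) (exprn_ge0 _ (ler0n _ _))).
  rewrite -powRrM mulVf ?gt_eqF // powRr1 // ltr_pdivrMr // ltNge => /negP; apply.
  by rewrite mulrC -ler_pdivlMr ?powR_gt0 ?exprn_gt0 //; apply: h;
    rewrite xz invr_gt0 exprn_gt0.
have {xz}x0 : 0 < x by rewrite lt_neqAle eq_sym xz.
have ex : exists n, (3 ^+ n.+2)^-1 <= x.
  exists (Num.truncn x^-1); rewrite invf_ple ?posrE ?exprn_gt0 //.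
  apply: le_trans (ltW (truncnS_gt _)) _; move: (Num.truncn _) => n.
  by rewrite -natrX ler_nat; apply: ltnW; apply: ltnW; exact: ltn_expl.
case: (ex_minnP ex) => -[|m] mx mmin.
  apply: le_trans yC _; rewrite -mulrA ler_peMr // -powRM ?(ltW x0) //.
  apply: (@le_trans _ _ (1 `^ s)); first by rewrite powR1.
  apply: ge0_ler_powR; rewrite ?nnegrE ?(ltW s0) ?mulr_ge0 ?(ltW x0) //.
  move: mx; rewrite -[_^-1]mul1r ler_pdivrMr ?exprn_gt0 // !exprS expr0; lra.
have xm : x < (3 ^+ m.+2)^-1 by rewrite ltNge; apply/negP => /mmin; rewrite ltnn.
apply: le_trans (h m xm) _; rewrite -mulrA ler_wpM2l // -powRM ?(ltW x0) //.
rewrite -[leLHS]mul1r ler_pdivrMr ?powR_gt0 ?exprn_gt0 //.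
rewrite -powRM ?mulr_ge0 ?(ltW x0) ?exprn_ge0 //; apply: (@le_trans _ _ (1 `^ s));
  first by rewrite powR1.
apply: ge0_ler_powR; rewrite ?nnegrE ?(ltW s0) ?mulr_ge0 ?(ltW x0) ?exprn_ge0 //.
by move: mx; rewrite -[_^-1]mul1r ler_pdivrMr ?exprn_gt0 // !exprS; lra.
Qed.

End Scales.

Section Measures.
Variable R : realType.
Implicit Types (a b : nat -> 'I_5) (s : state) (A : set R[i]).

Let sd : R := ln 5 / ln 3.

Lemma sd_gt0 : 0 < sd.
Proof. by rewrite divr_gt0 ?ln_gt0 //; lra. Qed.

Lemma powR3_sd : 3 `^ sd = 5.
Proof.
rewrite /powR gt_eqF // /sd divfK ?lnK ?posrE //.
by rewrite gt_eqF // ln_gt0 //; lra.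
Qed.

Lemma powR_third : 3^-1 `^ sd = 5^-1.
Proof. by rewrite -powR_inv1 // -powRrM mulN1r powRN powR3_sd. Qed.

Lemma powR_3n n : (3 ^+ n) `^ sd = 5 ^+ n.
Proof. by rewrite -powR_mulrn // -powRrM mulrC powRrM powR3_sd powR_mulrn. Qed.

Lemma hausdorff_measure_third A d :
  (hausdorff_measure sd [set (3^-1 * (z + d))%R | z in A] <=
   5^-1%:E * hausdorff_measure sd A)%E.
Proof.
rewrite -powR_third; apply: hausdorff_measure_image => //; first exact: ltW sd_gt0.
by move=> x y _ _; rewrite cdist_third.
Qed.

Lemma hausdorff_measure_triple A d :
  (hausdorff_measure sd [set (3 * z - d)%R | z in A] <= 5%:E * hausdorff_measure sd A)%E.
Proof.
rewrite -powR3_sd; apply: hausdorff_measure_image => //; first exact: ltW sd_gt0.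
move=> x y _ _; have := cdist_third (3 * x - d) (3 * y - d) d.
by rewrite !subrK !mulKf ?pnatr_eq0 // => ->; rewrite mulVKf.
Qed.

(** The domination makes [q] factor through [p], and the factor is Lipschitz with constant [L]. *)
Lemma hausdorff_measure_range (T : Type) (p q : T -> R[i]) L : 0 < L ->
  (forall i j, cdist (q i) (q j) <= L * cdist (p i) (p j)) ->
  (hausdorff_measure sd (range q) <= (L `^ sd)%:E * hausdorff_measure sd (range p))%E.
Proof.
move=> L0 pq; have /choice[f fp] : forall x, exists y, forall i, p i = x -> q i = y.
  move=> x; have [[a pa]|h] := pselect (exists i, p i = x); last first.
    by exists 0 => a pa; case: h; exists a.
  exists (q a) => b pb; have := pq b a; rewrite pa pb cdistxx mulr0 => h.
  have {}h : cdist (q b) (q a) = 0 by apply/eqP; rewrite eq_le h cdist_ge0.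
  by move: h => /Normc.eq0_normc/eqP; rewrite subr_eq0 => /eqP.
have -> : range q = f @` range p.
  apply/seteqP; split=> [_ [a _ <-]|_ [_ [a _ <-] <-]].
    by exists (p a); [exists a|rewrite -(fp (p a) a)].
  by exists a => //; exact: fp.
apply: hausdorff_measure_image => //; first exact: ltW sd_gt0.
by move=> _ _ [a _ <-] [b _ <-]; rewrite -!(fp _ _ erefl).
Qed.

Lemma cylinder_cons a n : cylinder a n.+1 =
  [set b | b 0%N = a 0%N /\ cylinder (shift a) n (shift b)].
Proof.
apply/seteqP; split=> [b ab|b [b0 bs] [|k] //].
  by split; [exact: ab|move=> k kn; exact: ab].
by rewrite ltnS; exact: bs.
Qed.

Lemma Fpoint_cylinder a n H : hausdorff_measure sd (range (@Fpoint R)) = H%:E ->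
  (hausdorff_measure sd (@Fpoint R @` cylinder a n) <= (H / 5 ^+ n)%:E)%E.
Proof.
move=> HE; elim: n a => [|n IHn] a.
  by rewrite expr0 divr1 -HE; apply: le_outer_measure => _ [b _ <-]; exists b.
apply: (@le_trans _ _ (5^-1%:E * hausdorff_measure sd (@Fpoint R @` cylinder (shift a)
  n))%E).
  apply: le_trans (hausdorff_measure_third _ (Fdigit R (a 0%N))).
  apply: le_outer_measure => _ [b + <-]; rewrite cylinder_cons => -[b0 bs].
  by rewrite FpointS b0; exists (Fpoint R (shift b)) => //; exists (shift b).
rewrite exprS invfM mulrCA EFinM lee_pmul2l ?lte_fin ?invr_gt0 //.
Qed.

(** Dropping the first digit changes the state, so the induction needs the bound [H] for all three
    states. *)
Lemma Epoint_cylinder s a n H :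
  (forall t, (hausdorff_measure sd (range (@Epoint R t)) <= H%:E)%E) ->
  (hausdorff_measure sd (@Epoint R s @` cylinder a n) <= (H / 5 ^+ n)%:E)%E.
Proof.
move=> HE; elim: n s a => [|n IHn] s a.
  rewrite expr0 divr1; apply: le_trans (HE s).
  by apply: le_outer_measure => _ [b _ <-]; exists b.
apply: (@le_trans _ _ (5^-1%:E * hausdorff_measure sd
    (@Epoint R (next s (a 0%N)) @` cylinder (shift a) n))%E).
  apply: le_trans (hausdorff_measure_third _ (Edigit R s (a 0%N))).
  apply: le_outer_measure => _ [b + <-]; rewrite cylinder_cons => -[b0 bs].
  by rewrite EpointS b0; exists (Epoint R (next s (a 0%N)) (shift b)) => //;
    exists (shift b).
by rewrite exprS invfM mulrCA EFinM lee_pmul2l ?lte_fin ?invr_gt0.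
Qed.

Let cons (d : 'I_5) a : nat -> 'I_5 := fun k => if k is m.+1 then a m else d.

(** The left range is one piece of the right one, enlarged three times. This makes the measures for
    [Lower] and [Upper] finite, so that the linear inequalities of [state_bound] can be solved over
    the reals. *)
Let Epoint_next s d :
  (hausdorff_measure sd (range (@Epoint R (next s d))) <=
   5%:E * hausdorff_measure sd (range (@Epoint R s)))%E.
Proof.
apply: le_trans (hausdorff_measure_triple _ (Edigit R s d)).
apply: le_outer_measure => _ [a _ <-]; exists (Epoint R s (cons d a)).
  by exists (cons d a).
by rewrite EpointS /= mulVKf ?pnatr_eq0 // addrK.
Qed.

Let Epoint_sum s : (hausdorff_measure sd (range (@Epoint R s)) <=
  \sum_(i < 5) 5^-1%:E * hausdorff_measure sd (range (@Epoint R (next s i))))%E.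
Proof.
pose G k := [set 3^-1 * (z + Edigit R s (inord k)) | z in range (@Epoint R (next s
  (inord k)))].
apply: (@le_trans _ _ (\sum_(i < 5) hausdorff_measure sd (G i))%E).
  apply: (le_trans _ (outer_measure_subadditive (hausdorff_measure sd) G _)).
  rewrite -(bigcup_mkord _ G); apply: le_outer_measure => _ [a _ <-].
  exists (val (a 0%N)); first exact: ltn_ord.
  by rewrite /G inord_val EpointS; exists (Epoint R (next s (a 0%N)) (shift a)) => //.
by apply: lee_sum => i _; rewrite /G inord_val; exact: hausdorff_measure_third.
Qed.

(* The values [l], [u] and [h] at [Lower], [Upper] and [Single] satisfy
   [5 l <= 3 h + l + u] and [5 u <= h + 2 l + 2 u], whence [l, u <= h]. *)
Let state_bound (k : state -> \bar R) (h : R) : (forall s, 0 <= k s)%E ->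
  (forall s d, k (next s d) <= 5%:E * k s)%E ->
  (forall s, k s <= \sum_(i < 5) 5^-1%:E * k (next s i))%E ->
  k Single = h%:E -> forall s, (k s <= h%:E)%E.
Proof.
move=> k0 knext ksum kh.
have fin d : k (next Single d) \is a fin_num.
  by rewrite ge0_fin_numE // (le_lt_trans (knext Single d)) // kh -EFinM ltry.
have := ksum Lower; have := ksum Upper.
rewrite !big_ord_recl !big_ord0 /next /= kh.
have := fin (@Ordinal 5 2 isT); have := fin (@Ordinal 5 3 isT); rewrite /next /=.
case kU : (k Upper) => [u| |] // _; case kL : (k Lower) => [l| |] // _.
rewrite -!EFinM !adde0 -!EFinD !lee_fin => hu hl.
by case; rewrite ?kh ?kU ?kL lee_fin //; lra.
Qed.

Lemma Epoint_le_Single H : hausdorff_measure sd (range (@Epoint R Single)) = H%:E ->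
  forall s, (hausdorff_measure sd (range (@Epoint R s)) <= H%:E)%E.
Proof.
apply: (state_bound (fun s => hausdorff_measure_ge0 _ _)).
- exact: Epoint_next.
- exact: Epoint_sum.
Qed.

End Measures.

(** * Finiteness and positivity of the measure of [F] *)

Section MeasureOfF.
Variable R : realType.
Implicit Types (a b : nat -> 'I_5) (t : R).

Local Notation sd := (ln 5 / ln 3 : R).
Local Notation unit_itv := (`[0, 1[%classic : set R).
Local Notation K := (range (@Fpoint R)).

Let Fpoint_dist a b : cdist (Fpoint R a) (Fpoint R b) <= 10.
Proof. by have := cdist_Fpoint_le R a b 0;
  rewrite expr0 mul1r [X in X + 10](_ : _ = 0) ?add0r. Qed.

(** [K] has diameter at most 10 and consists of five copies reduced by 3. As [5 * 3^-1 ^ sd = 1],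
    the bound survives division of the scale by 3. *)
Let content_F n : (hausdorff_content sd (10 / 3 ^+ n) K <= (10 `^ sd)%:E)%E.
Proof.
elim: n => [|n IHn].
  rewrite expr0 divr1; apply: (@le_trans _ _ (diam_pow sd K)); last first.
    have dK : (diam K <= 10%:E)%E.
      by apply: diam_le => // _ _ [a _ <-] [b _ <-]; rewrite lee_fin Fpoint_dist.
    have K0 : K !=set0 by exists (Fpoint R (fun=> ord0)), (fun=> ord0).
    rewrite (diam_pow_fin _ K0 dK) lee_fin; apply: ge0_ler_powR; rewrite ?nnegrE.
    - exact: ltW (sd_gt0 R).
    - by rewrite fine_ge0 // diam_ge0.
    - by [].
    by rewrite -lee_fin fineK // ge0_fin_numE ?diam_ge0 // (le_lt_trans dK) // ltry.
  pose U n := if n is 0%N then K else set0.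
  apply: (@le_trans _ _ (\sum_(0 <= n <oo) diam_pow sd (U n))%E).
    apply: ereal_inf_lbound; exists U => //; split=> [x Kx|[|m]]; first by exists 0%N.
      by apply: diam_le => // _ _ [a _ <-] [b _ <-]; rewrite lee_fin Fpoint_dist.
    by rewrite /= diam_set0.
  rewrite nneseries_recl // => [|m _]; last exact: diam_pow_ge0.
  by rewrite eseries0 ?adde0 // => -[|m] // _ _; rewrite /= diam_pow_set0.
apply: le_trans IHn.
have e0 : 0 < 10 / 3 ^+ n :> R by rewrite divr_gt0 ?exprn_gt0.
have e1 : 0 < 10 / 3 ^+ n.+1 :> R by rewrite divr_gt0 ?exprn_gt0.
pose G k := [set 3^-1 * (z + Fdigit R (inord k)) | z in K].
apply: (@le_trans _ _ (\sum_(i < 5) hausdorff_content sd (10 / 3 ^+ n.+1) (G i))%E).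
  apply: (le_trans _ (outer_measure_subadditive (pos_content sd (PosNum e1)) G _)).
  rewrite -(bigcup_mkord _ G); apply: le_content => _ [a _ <-].
  exists (val (a 0%N)); first exact: ltn_ord.
  by rewrite /G inord_val FpointS; exists (Fpoint R (shift a)).
apply: (@le_trans _ _ (\sum_(i < 5) 5^-1%:E * hausdorff_content sd (10 / 3 ^+ n) K)%E).
  apply: lee_sum => i _.
  have -> : 10 / 3 ^+ n.+1 = 3^-1 * (10 / 3 ^+ n) :> R by rewrite exprS invfM; ring.
  rewrite -(powR_third R).
  apply: content_image => //; first exact: ltW (sd_gt0 R).
  by move=> x y _ _; rewrite cdist_third.
rewrite -ge0_sume_distrl => [|i _]; last by rewrite lee_fin invr_ge0.
rewrite sumEFin !big_ord_recl big_ord0.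
have -> : 5^-1 + (5^-1 + (5^-1 + (5^-1 + (5^-1 + 0)))) = 1 :> R by lra.
by rewrite mul1e.
Qed.

Lemma hausdorff_measure_F_fin : (hausdorff_measure sd K < +oo)%E.
Proof.
apply: (@le_lt_trans _ _ (10 `^ sd)%:E); last exact: ltry.
apply: hausdorff_measure_le => d.
apply: le_trans (content_F (Num.truncn (10 / d%:num)).+1).
apply: le_content_delta; rewrite ler_pdivrMr ?exprn_gt0 // mulrC -ler_pdivrMr //.
apply: le_trans (ltW (truncnS_gt _)) _; move: (Num.truncn _).+1 => n.
by rewrite -natrX ler_nat ltnW // ltn_expl.
Qed.

Lemma word_itv n k : [set t | unit_itv t /\ word (digits t) n = k] =
  unit_itv `&` `[k%:R / 5 ^+ n, k.+1%:R / 5 ^+ n[%classic.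
Proof.
have p5 : 0 < 5 ^+ n :> R by rewrite exprn_gt0.
have E t : 0 <= t < 1 -> word (digits t) n = k <-> k%:R / 5 ^+ n <= t < k.+1%:R / 5 ^+ n.
  move=> t01; have t0 : 0 <= 5 ^+ n * t by case/andP: t01 => ? _;
    rewrite mulr_ge0 ?(ltW p5).
  rewrite word_digits // ler_pdivrMr // ltr_pdivlMr // [t * _]mulrC; split=> [<-|].
    exact: truncn_itv.
  exact: truncn_def.
by apply/seteqP; split=> t /= -[t01 h]; split=> //; move: t01 h;
  rewrite !in_itv /= => /E[].
Qed.

Lemma lebesgue_word_le n k :
  (lebesgue_measure [set t | unit_itv t /\ word (digits t) n = k] <= (5 ^- n)%:E)%E.
Proof.
have p5 : 0 < 5 ^+ n :> R by rewrite exprn_gt0.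
rewrite word_itv; apply: (@le_trans _ _
  (lebesgue_measure (`[k%:R / 5 ^+ n, k.+1%:R / 5 ^+ n[%classic : set R))).
  by apply: (le_outer_measure (mu_ext (wlength idfun))); exact: subIsetr.
rewrite lebesgue_measure_itv /= lte_fin ltr_pM2r ?invr_gt0 // ltr_nat ltnSn.
by rewrite -EFinB lee_fin -mulrBl -natrB // subSnn mul1r.
Qed.

Let slice (U : set R[i]) := unit_itv `&` [set t | U (Fpoint R (digits t))].

(** By [lat_Fnear], the cells of level [m] concerned are in one column within one row of a fixed
    cell: at most three words, each of Lebesgue measure at most [5 ^- m]. As [U] is arbitrary, the
    sum is taken with the outer measure. *)
Let slice_le (U : set R[i]) m : (forall x y, U x -> U y -> cdist x y < (3 ^+ m.+2)^-1) ->
  (lebesgue_measure (slice U) <= (3 / 5 ^+ m)%:E)%E.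
Proof.
move=> Um; have [->|/set0P[t0 [t01 Ut0]]] := eqVneq (slice U) set0.
  by rewrite measure0 lee_fin divr_ge0 ?exprn_ge0.
pose x0 := lat (Fxs (digits t0)) m; pose y0 := lat (Fys (digits t0)) m.
pose A (j : nat) := [set t | unit_itv t /\ lat (Fxs (digits t)) m = x0 /\
  lat (Fys (digits t)) m = y0 + (j%:Z - 1)].
have AU : slice U `<=` \bigcup_(j < 3) A j.
  move=> t [t1 Ut]; have [px py] := Fpoint_sep (Um _ _ Ut Ut0).
  have [qx qy] := lat_Fnear px py.
  have [y1|[y1|y1]] : lat (Fys (digits t)) m = y0 + -1 \/ lat (Fys (digits t)) m = y0 + 0
      \/ lat (Fys (digits t)) m = y0 + 1 by rewrite /y0; lia.
  - by exists 0%N.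
  - by exists 1%N.
  - by exists 2%N.
have Aj j : (mu_ext (wlength idfun) (A j) <= (5 ^- m)%:E)%E.
  have [A0|/set0P[t1 [t11 [xt yt]]]] := eqVneq (A j) set0.
    by rewrite A0 mu_ext0 ?lee_fin ?invr_ge0 ?exprn_ge0 // => X; exact: wlength_ge0.
  apply: le_trans (lebesgue_word_le m (word (digits t1) m)).
  apply: (le_outer_measure (mu_ext (wlength idfun))) => t [t1' [xt' yt']]; split=> //.
  have e := lat_inj (etrans xt' (esym xt)) (etrans yt' (esym yt)).
  exact: eq_word e.
rewrite bigcup_mkord in AU.
apply: le_trans (le_outer_measure (mu_ext (wlength idfun)) _ _ AU) _.
apply: le_trans (outer_measure_subadditive (mu_ext (wlength idfun)) _ _) _.
rewrite !big_ord_recl big_ord0 adde0.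
have -> : (3 / 5 ^+ m)%:E = ((5 ^- m)%:E + ((5 ^- m)%:E + (5 ^- m)%:E))%E :> \bar R.
  by rewrite -!EFinD; congr EFin; ring.
by apply: leeD; [|apply: leeD]; exact: Aj.
Qed.

Let slice_diam (U : set R[i]) : (diam U <= 1%:E)%E ->
  (lebesgue_measure (slice U) <= (3 * 27 `^ sd)%:E * diam_pow sd U)%E.
Proof.
move=> U1; have [->|/set0P U0] := eqVneq U set0.
  have -> : slice set0 = set0 by apply/seteqP; split=> // t [].
  by rewrite measure0 diam_pow_set0 mule0.
rewrite (diam_pow_fin _ U0 U1) -EFinM.
have dfin : diam U = (fine (diam U))%:E.
  by rewrite fineK // ge0_fin_numE ?diam_ge0 // (le_lt_trans U1) // ltry.
have lfin : (lebesgue_measure (slice U) <= 1%:E :> \bar R)%E.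
  apply: (@le_trans _ _ (lebesgue_measure unit_itv)).
    by apply: (le_outer_measure (mu_ext (wlength idfun))); exact: subIsetl.
  by rewrite lebesgue_measure_itv /= lte_fin ltr01 sube0.
have l0 : (0 <= lebesgue_measure (slice U) :> \bar R)%E.
  exact: (outer_measure_ge0 (mu_ext (wlength idfun))).
have h n : fine (diam U) < (3 ^+ n.+2)^-1 ->
    (lebesgue_measure (slice U) <= (3 / (3 ^+ n) `^ sd)%:E)%E.
  move=> Un; rewrite powR_3n; apply: slice_le => x y Ux Uy; apply: le_lt_trans Un.
  by rewrite -lee_fin -dfin le_cdist_diam.
move: lfin l0 h; case: (lebesgue_measure _) => [l| |] //; rewrite !lee_fin => l1 l0 h.
apply: scale_power => //; first exact: sd_gt0.
- by rewrite fine_ge0 // diam_ge0.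
- lra.
Qed.

Lemma hausdorff_measure_F_gt0 : (0 < hausdorff_measure sd K)%E.
Proof.
apply: lt_le_trans (content_le_measure sd K ltr01).
pose C : R := 3 * 27 `^ sd.
have C0 : 0 < C by rewrite mulr_gt0 ?powR_gt0.
apply: (@lt_le_trans _ _ (C^-1)%:E); first by rewrite lte_fin invr_gt0.
apply: le_ereal_inf_tmp => _ [U [KU Ud] <-].
rewrite -(@lee_pmul2l _ C%:E) ?lte_fin // -EFinM mulfV ?gt_eqF //.
rewrite -nneseriesZl; last by move=> n _; exact: diam_pow_ge0.
apply: (@le_trans _ _ (\sum_(0 <= n <oo) mu_ext (wlength idfun) (slice (U n)))%E).
  apply: (@le_trans _ _ (lebesgue_measure unit_itv)).
    by rewrite lebesgue_measure_itv /= lte_fin ltr01 sube0.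
  apply: le_trans (outer_measure_sigma_subadditive (mu_ext (wlength idfun)) _).
  apply: (le_outer_measure (mu_ext (wlength idfun))) => t t01.
  by have [n _ Un] := KU (Fpoint R (digits t)) (ex_intro2 _ _ _ I erefl); exists n.
apply: lee_nneseries => [n _ _|n _]; last exact: slice_diam.
exact: (outer_measure_ge0 (mu_ext (wlength idfun))).
Qed.

End MeasureOfF.

(** * Identification of [E] and [F], measurability of codes, and the theorem *)

Section Conclusion.
Variable R : realType.
Implicit Types (a b : nat -> 'I_5) (s : state) (A E F : set R[i]).

Local Notation sd := (ln 5 / ln 3 : R).

Lemma cdist_eq0 (x y : R[i]) : cdist x y = 0 -> x = y.
Proof. by rewrite /cdist => /Normc.eq0_normc/eqP; rewrite subr_eq0 => /eqP. Qed.

Lemma cdist_small (x y : R[i]) M : (forall n, cdist x y <= M / 3 ^+ n) -> x = y.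
Proof.
move=> h; apply: cdist_eq0; apply/eqP; rewrite eq_le cdist_ge0 andbT.
by apply: (@le_approx _ _ _ M) => m; rewrite add0r.
Qed.

Lemma exp3_small (M e : R) : 0 < e -> exists n, M / 3 ^+ n < e.
Proof.
move=> e0; exists (Num.truncn (M / e)).+1.
rewrite ltr_pdivrMr ?exprn_gt0 // mulrC -ltr_pdivrMr //.
apply: lt_le_trans (truncnS_gt _) _; move: (Num.truncn _).+1 => n.
by rewrite -natrX ler_nat ltnW // ltn_expl.
Qed.

Lemma digitsF_map : digitsF R = [seq Fdigit R d | d <-
  [:: @Ordinal 5 0 isT; @Ordinal 5 1 isT; @Ordinal 5 2 isT; @Ordinal 5 3 isT;
    @Ordinal 5 4 isT]].
Proof. by []. Qed.

Lemma Fdigit_in (d : 'I_5) : Fdigit R d \in digitsF R.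
Proof.
by rewrite digitsF_map map_f //; case: d => [[|[|[|[|[|]]]]] ?].
Qed.

(** A point of [F] receives its digits by repeatedly choosing a preimage; conversely, prefixing
    digits to a fixed point of [F] approaches any coded point. Each digit divides the error [M + 10]
    by 3. *)
Lemma F_range F : is_attractor (digitsF R) F -> F = range (@Fpoint R).
Proof.
move=> [[y0 Fy0] cF FE]; have [M FM] := compact_bound cF.
have M5 x a : F x -> cdist x (Fpoint R a) <= M + 10.
  move=> Fx; apply: le_trans (cdist_triangle 0 _ _) _; rewrite lerD ?FM //.
  apply: le_trans (cdist_le_ReIm _ _ _ _) _; rewrite !sub0r !normrN.
  by have := norm_expand R (Fxs_le5 a); have := norm_expand R (Fys_le5 a); lra.
apply/seteqP; split=> [x Fx|_ [a _ <-]].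
- have /choice[f fP] : forall x, exists dy : 'I_5 * R[i],
      F x -> F dy.2 /\ x = 3^-1 * (dy.2 + Fdigit R dy.1).
    move=> z; have [Fz|nFz] := pselect (F z); last by exists (ord0, 0).
    move: (Fz); rewrite {1}FE => -[y Fy [d dF <-]].
    by move: dF; rewrite /= digitsF_map => /mapP[e _ ->]; exists (e, y).
  exists (fun k => (f (iter k (fun z => (f z).2) x)).1) => //.
  apply/esym/(@cdist_small _ _ (M + 10)) => n.
  elim: n x Fx => [|n IHn] x Fx; first by rewrite expr0 divr1 M5.
  have [Ff xE] := fP x Fx; rewrite FpointS {1}xE cdist_third exprS invfM mulrCA.
  rewrite ler_pM2l ?invr_gt0 //.
  rewrite (_ : shift _ = fun k => (f (iter k (fun z => (f z).2) (f x).2)).1);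
    first exact: IHn.
  by apply/funext => k; rewrite /shift iterSr.
- apply: (compact_limit cF) => e e0; have [n ne] := exp3_small (M + 10) e0.
  suff [y Fy yn] : exists2 y, F y & cdist y (Fpoint R a) <= (M + 10) / 3 ^+ n.
    by exists y => //; exact: le_lt_trans ne.
  elim: n a {ne} => [|n IHn] a; first by exists y0 => //; rewrite expr0 divr1 M5.
  have [y Fy yn] := IHn (shift a); exists (3^-1 * (y + Fdigit R (a 0%N))).
    by rewrite FE; exists y => //; exists (Fdigit R (a 0%N)) => //; exact: Fdigit_in.
  by rewrite FpointS cdist_third exprS invfM mulrCA ler_pM2l ?invr_gt0.
Qed.

Lemma Epoint_lipschitz a b : cdist (Epoint R Single a) (Epoint R Single b) <=
  (12 * 27) * cdist (Fpoint R a) (Fpoint R b).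
Proof.
rewrite -[27](powRr1) // -[cdist (Fpoint R a) _]powRr1 ?cdist_ge0 //.
apply: scale_power; rewrite ?cdist_ge0 //.
  have := cdist_Epoint_le R Single Single a b 0.
  by rewrite expr0 mul1r [X in X + 10](_ : _ = 0) ?add0r // => h;
    rewrite (le_trans h) //; lra.
by move=> n /near_Fpoint_Epoint; rewrite powRr1 // exprn_ge0.
Qed.

Lemma Fpoint_lipschitz a b : cdist (Fpoint R a) (Fpoint R b) <=
  (12 * 27) * cdist (Epoint R Single a) (Epoint R Single b).
Proof.
rewrite -[27](powRr1) // -[cdist (Epoint R _ a) _]powRr1 ?cdist_ge0 //.
apply: scale_power; rewrite ?cdist_ge0 //.
  have := cdist_Fpoint_le R a b 0.
  by rewrite expr0 mul1r [X in X + 10](_ : _ = 0) ?add0r // => h;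
    rewrite (le_trans h) //; lra.
move=> n ab; rewrite powRr1 ?exprn_ge0 //; apply: near_Epoint_Fpoint;
  apply: lt_trans ab _.
by rewrite ltf_pV2 ?posrE ?exprn_gt0 // ltr_eXn2l //; lra.
Qed.

(** [E_near_Epoint] gives a code for each precision, not one code for all. Compactness is borrowed
    from [F]: a cluster point of the points [Fpoint (u n)] has a code, and [Epoint_lipschitz]
    carries the approximation back to [E]. *)
Lemma E_range E F : is_attractor (digitsE R) E -> is_attractor (digitsF R) F ->
  E = range (@Epoint R Single).
Proof.
move=> [E0 cE EE] hF; have [_ cF _] := hF; have FE := F_range hF.
have [M EM] := compact_bound cE.
have bound s a z : (E `|` [set z + (0 +i* 1)%C | z in E]) z ->
    cdist z (Epoint R s a + offset R s) <= M + 10.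
  have Es : cdist 0 (Epoint R s a + offset R s) <= 9.
    have := norm_expand R (Exs_le5 a); have := norm_expand R (Eys_le5 s a).
    have [u u1 ->] : exists2 u : R, `|u| <= 1 & offset R s = (0 +i* u)%C.
      by case: s; [exists 0|exists 0|exists 1]; rewrite ?normr0 ?normr1.
    rewrite /Epoint => hy hx; apply: le_trans (cdist_le_ReIm _ _ _ _) _.
    rewrite !sub0r !normrN addr0; have := ler_normD (expand R (Eys s a)) u; lra.
  case=> [Ez|[w Ew <-]]; apply: le_trans (cdist_triangle 0 _ _) _.
    by have := EM _ Ez; lra.
  have : cdist (w + (0 +i* 1)%C) 0 <= M + 1.
    apply: le_trans (cdist_triangle w _ _) _; rewrite addrC lerD ?EM //.
    rewrite /cdist addrAC subrr add0r /= expr0n add0r expr1n sqrtr1 //.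
  by lra.
apply/seteqP; split=> [x Ex|_ [a _ <-]].
- have /choice[u un] : forall n, exists a, cdist x (Epoint R Single a) <= (M + 10) / 3
  ^+ n.
    by move=> n; exact: (E_near_Epoint bound EE).
  have Fu n : F (Fpoint R (u n)) by rewrite FE; exists (u n).
  have [y Fy yu] := compact_seq cF Fu.
  move: Fy; rewrite FE => -[a _ ay]; exists a => //.
  apply/esym/(@cdist_small _ _ (M + 10 + 12 * 27)) => n.
  have p3 : 0 < 3 ^- n :> R by rewrite invr_gt0 exprn_gt0.
  have [m nm um] := yu _ n p3.
  apply: le_trans (cdist_triangle (Epoint R Single (u m)) _ _) _; rewrite mulrDl lerD //.
    apply: le_trans (un m) _; rewrite ler_wpM2l ?lef_pV2 ?posrE ?exprn_gt0 //.
      by have [z Ez] := E0; have := bound Single a z (or_introl Ez);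
        have := cdist_ge0 z (Epoint R Single a + offset R Single); lra.
    by rewrite ler_eXn2l //; lra.
  apply: le_trans (Epoint_lipschitz _ _) _; rewrite ler_wpM2l // ay ltW //.
- apply: (compact_limit cE) => e e0; have [n ne] := exp3_small (M + 10) e0.
  have [y Ey yn] := Epoint_near_E E0 bound EE n a.
  by exists y => //; exact: le_lt_trans ne.
Qed.

Lemma Epoint_continuous a n b : cylinder a n b ->
  cdist (Epoint R Single a) (Epoint R Single b) <= 10 / 3 ^+ n.
Proof.
move=> ab; rewrite ler_pdivlMr ?exprn_gt0 // mulrC.
apply: le_trans (cdist_Epoint_le R Single Single a b n) _.
have -> : lat (Exs a) n = lat (Exs b) n.
  by apply: eq_lat => k kn; rewrite /Exs ab.
have -> : lat (Eys Single a) n = lat (Eys Single b) n.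
  apply: eq_lat => k kn; rewrite /Eys ab //; congr (_ + 3 * swap _ _).
  by apply: eq_run => j jk; rewrite ab // (ltn_trans jk).
by rewrite !subrr [X in X + 10](_ : _ = 0) ?add0r.
Qed.

(** The sets with measurable preimage form a sigma-algebra. It contains the open sets because
    [Epoint_continuous] makes the preimage of an open set a countable union of pentadic
    intervals. *)
Lemma measurable_coding (B : set R[i]) : borel B ->
  measurable ((`[0, 1[%classic : set R) `&` (@digits R @^-1` [set a | B (Epoint R
    Single a)])).
Proof.
set I := (`[0, 1[%classic : set R).
pose G := [set U : set R[i] | measurable (I `&` (@digits R @^-1` [set a | U (Epoint R
  Single a)]))].
have mI : measurable I by exact: measurable_itv.
apply: (@smallest_sub _ _ _ G); first split.
- rewrite /G /= (_ : I `&` _ = set0); first exact: measurable0.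
  by apply/seteqP; split=> // t [].
- move=> U; rewrite /G /= => mU.
  rewrite (_ : I `&` _ = I `\` (I `&` (@digits R @^-1` [set a | U (Epoint R Single a)]))).
    exact: measurableD.
  apply/seteqP; split=> t.
    by move=> [It [_ nU]]; split=> // -[].
  by move=> [It nU]; split=> //; split=> // Ut; apply: nU.
- move=> U mU; rewrite /G /=.
  rewrite (_ : I `&` _ = \bigcup_n (I `&` (@digits R @^-1` [set a | U n (Epoint R
    Single a)]))).
    exact: bigcupT_measurable.
  apply/seteqP; split=> t.
    by move=> [It [n _ Un]]; exists n.
  by move=> [n _ [It Un]]; split=> //; exists n.
move=> U oU; rewrite /G /=.
pose J n k := [set t | I t /\ word (digits t) n = k].
pose good n k := forall t, J n k t -> U (Epoint R Single (digits t)).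
rewrite (_ : I `&` _ = \bigcup_n \bigcup_k (if `[< good n k >] then J n k else set0)).
  apply: bigcupT_measurable => n; apply: bigcupT_measurable => k.
  case: ifP => _; last exact: measurable0.
  by rewrite /J word_itv; apply: measurableI => //; exact: measurable_itv.
apply/seteqP; split=> [t [It Ut]|t [n _ [k _ +]]]; last first.
  by case: asboolP => [g Jt|_ []]; split; [case: Jt|exact: g].
have [e e0 eU] := open_cdist oU Ut; have [n ne] := exp3_small 10 e0.
exists n => //; exists (word (digits t) n) => //.
rewrite /= asboolT // => u [Iu wu]; apply: eU.
apply: le_lt_trans ne; apply: Epoint_continuous; apply: word_inj; exact: wu.
Qed.

End Conclusion.

Theorem theorem1p2 (R : realType) (E F : set R[i])
    (hE : is_attractor (digitsE R) E) (hF : is_attractor (digitsF R) F) :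
  let s : R := ln 5 / ln 3 in
  let c : \bar R := (hausdorff_measure s E / hausdorff_measure s F)%E in
  hausdorff_dim E = s%:E /\
  exists f : R[i] -> R[i],
    bilipschitz E F f /\
    forall B : set R[i], borel B -> B `<=` E ->
      hausdorff_measure s B = (c * hausdorff_measure s (f @` B))%E.
Proof.
move=> s c.
have s_gt0 : 0 < s := sd_gt0 R.
have EE : E = range (@Epoint R Single) := E_range hE hF.
have FE : F = range (@Fpoint R) := F_range hF.
have L0 : 0 < 12 * 27 :> R by lra.
have Ffin : (hausdorff_measure s F < +oo)%E by rewrite FE; exact: hausdorff_measure_F_fin.
have Fpos : (0 < hausdorff_measure s F)%E by rewrite FE; exact: hausdorff_measure_F_gt0.
(* Finiteness and positivity pass from [F] to [E] through the two Lipschitz comparisons of the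
   codings. *)
have Efin : (hausdorff_measure s E < +oo)%E.
  rewrite EE; apply: le_lt_trans (hausdorff_measure_range L0 (@Epoint_lipschitz R)) _.
  by rewrite -FE lte_mul_pinfty // ?lee_fin ?powR_ge0.
have Epos : hausdorff_measure s E != 0%E.
  apply: contraTneq Fpos => E0; rewrite -leNgt FE.
  apply: le_trans (hausdorff_measure_range L0 (@Fpoint_lipschitz R)) _.
  by rewrite -EE E0 mule0.
split; first exact: hausdorff_dim_eq (ltW s_gt0) Epos Efin.
have fineE : (fine (hausdorff_measure s E))%:E = hausdorff_measure s E.
  by rewrite fineK // ge0_fin_numE // hausdorff_measure_ge0.
have fineF : (fine (hausdorff_measure s F))%:E = hausdorff_measure s F.
  by rewrite fineK // ge0_fin_numE // hausdorff_measure_ge0.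
(* A point of [E] may have several codes; [Fpoint_lipschitz] shows that they all name the same point
   of [F]. Outside [E] the value 0 is arbitrary. *)
have /choice[f fP] : forall x, exists y, forall a, Epoint R Single a = x -> Fpoint R a = y.
  move=> x; have [[a ax]|h] := pselect (exists a, Epoint R Single a = x); last first.
    by exists 0 => a ax; case: h; exists a.
  exists (Fpoint R a) => b bx; apply: cdist_eq0; apply/eqP.
  rewrite eq_le cdist_ge0 andbT.
  apply: (le_trans (Fpoint_lipschitz R b a)).
  by rewrite ax bx cdistxx mulr0.
have fE a : f (Epoint R Single a) = Fpoint R a by rewrite -(fP _ a).
exists f; split.
  split; first split.
  - by move=> x; rewrite EE FE => -[a _ <-]; rewrite fE; exists a.
  - move=> x y; rewrite !inE EE => -[a _ <-] [b _ <-]; rewrite !fE => ab.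
    apply: cdist_eq0; apply/eqP; rewrite eq_le cdist_ge0 andbT.
    by apply: le_trans (Epoint_lipschitz R _ _) _; rewrite ab cdistxx mulr0.
  - move=> y; rewrite FE EE => -[a _ <-]; exists (Epoint R Single a); last exact: fE.
    by exists a.
  exists (12 * 27) => // x1 x2; rewrite EE => -[a _ <-] [b _ <-]; rewrite !fE.
  apply/andP; split; last exact: Fpoint_lipschitz.
  by rewrite ler_pdivrMl //; exact: Epoint_lipschitz.
move=> B bB BE; pose S := [set a | B (Epoint R Single a)].
have BS : B = @Epoint R Single @` S.
  apply/seteqP; split=> [x Bx|_ [a Sa <-] //].
  by have := BE x Bx; rewrite EE => -[a _ ax]; exists a => //; rewrite /S /= ax.
have fBS : f @` B = @Fpoint R @` S.
  rewrite BS; apply/seteqP; split=> [_ [_ [a Sa <-] <-]|_ [a Sa <-]].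
    by exists a => //; rewrite fE.
  by exists (Epoint R Single a); [exists a|rewrite fE].
have mS := measurable_coding bB.
have rE : hausdorff_measure s (range (@Epoint R Single)) = (fine (hausdorff_measure s E))%:E.
  by rewrite -EE fineE.
have rF : hausdorff_measure s (range (@Fpoint R)) = (fine (hausdorff_measure s F))%:E.
  by rewrite -FE fineF.
have E_ge0 : 0 <= fine (hausdorff_measure s E) by rewrite fine_ge0 ?hausdorff_measure_ge0.
have F_ge0 : 0 <= fine (hausdorff_measure s F) by rewrite fine_ge0 ?hausdorff_measure_ge0.
have hB := hausdorff_measure_param s_gt0 E_ge0
  (fun a n => Epoint_cylinder Single a n (Epoint_le_Single rE)) rE mS.
have hfB := hausdorff_measure_param s_gt0 F_ge0
  (fun a n => Fpoint_cylinder a n rF) rF mS.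
have F0 : fine (hausdorff_measure s F) != 0 by rewrite gt_eqF // -lte_fin fineF.
rewrite fBS BS hB hfB muleA; congr (_ * _)%E; rewrite /c.
move: (fine _) (fine _) fineE fineF F0 => h e <- <- h0.
by rewrite inver (negPf h0) -!EFinM divfK.
Qed.
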